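(* The generating function $G(x,y)\equiv G(t,x,y,w)$ is algebraic. Moreover, writing $t=z(1-z)^3$ (with $z=z(t)=t+O(t^2)$ the corresponding formal power series), the series $G(1,1)$ satisfies $C(G(1,1),z,w)=0$, where $$\begin{aligned}C(h,z,w)={}&wz(-1+z)^9h^3+(-1+z)^6(2w^2z^2-w^2z+2z^2+w-z)h^2\\&-(-1+z)^3(w^2z^3-3w^2z^2-2wz^3+w^2z-2wz^2+z^3+5wz-3z^2-2w+z)h\\&+4wz^2-4wz+w.\end{aligned}$$
   Context: $G(x,y)=\sum_{n\ge0}t^n\sum_{(P,Q)\in\mathcal{I}_n}\sum_{i=0}^{2n}w^{P(i)}x^{\mathrm{contact}_{<i}(P)}y^{\mathrm{contact}_{\ge i}(P)}$, so that $G(1,1)=\sum_{n}t^n\sum_{(P,Q)\in\mathcal{I}_n}\sum_{i=0}^{2n}w^{P(i)}$. Here a Dyck path of size $n$ is a lattice path from $(0,0)$ to $(2n,0)$ with $n$ up-steps $(1,1)$ and $n$ down-steps $(1,-1)$ never going below height $0$; $P(i)$ is its height at abscissa $i$; a contact is a vertex on the $x$-axis, and $\mathrm{contact}_{<i}(P)$, $\mathrm{contact}_{\ge i}(P)$ count contacts with abscissa $<i$, resp. $\ge i$. The Tamari order is the reflexive transitive closure of the relation: if $P$ has a down-step $d$ immediately followed by an up-step and $\mathfrak{e}$ is the shortest excursion following $d$ (staying strictly above its starting height except at its last point), the path obtained by exchanging $d$ and $\mathfrak{e}$ is larger than $P$. $\mathcal{I}_n$ is the set of pairs $(P,Q)$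 of Dyck paths of size $n$ with $P\le Q$. *)

(* Defs.v *)
From HB Require Import structures.
From mathcomp Require Import all_boot all_order all_algebra.
From mathcomp Require Import mpoly.
Set Implicit Arguments. Unset Strict Implicit. Unset Printing Implicit Defensive.
Import Order.TTheory GRing.Theory Num.Theory.
Local Open Scope ring_scope.

(** * Dyck paths, encoded as boolean sequences (true = up-step, false = down-step) *)

Definition height (s : seq bool) (i : nat) : int :=
  (count id (take i s))%:Z - (count negb (take i s))%:Z.

Definition isDyck (n : nat) (s : seq bool) : bool :=
  [&& size s == (2 * n)%N, count id s == n
    & all (fun i => 0 <= height s i) (iota 0 (size s).+1)].

Definition contact_lt (s : seq bool) (i : nat) : nat :=
  count (fun j => height s j == 0) (iota 0 i).

Definition contact_ge (s : seq bool) (i : nat) : nat :=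
  count (fun j => height s j == 0) (iota i ((size s).+1 - i)).

(** The down step d is step number k (from vertex k to vertex k+1), followed
    by an up step (step k+1).  The shortest excursion e following d starts at
    vertex k+1 and ends at the first vertex m > k+1 at the same height. *)
Definition excursion_end (s : seq bool) (k : nat) : nat :=
  (k.+2 + find (fun j => height s j == height s k.+1)
                (iota k.+2 ((size s) - k.+1)))%N.

Definition tamari_move_ok (s : seq bool) (k : nat) : bool :=
  (nth true s k == false) && (nth false s k.+1 == true).

(** exchange d and e *)
Definition tamari_move (s : seq bool) (k : nat) : seq bool :=
  let m := excursion_end s k in
  take k s ++ drop k.+1 (take m s) ++ false :: drop m s.

Definition tamari_cover (n : nat) : rel ((2 * n).-tuple bool) :=
  fun p q => isDyck n p &&
    [exists k : 'I_(2 * n), tamari_move_ok p k && (val q == tamari_move p k)].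

Definition tamari_le (n : nat) (p q : (2 * n).-tuple bool) : bool :=
  connect (@tamari_cover n) p q.

Definition is_interval (n : nat) (p q : (2 * n).-tuple bool) : bool :=
  [&& isDyck n p, isDyck n q & tamari_le p q].

Definition ser (R : Type) := nat -> R.

Section Series.
Variable R : comNzRingType.
Definition szero : ser R := fun _ => 0.
Definition sadd (f g : ser R) : ser R := fun n => f n + g n.
Definition sneg (f : ser R) : ser R := fun n => - f n.
Definition smul (f g : ser R) : ser R :=
  fun n => \sum_(i < n.+1) f i * g (n - i)%N.
Definition sconst (c : R) : ser R := fun n => if n == 0%N then c else 0.
Definition sone : ser R := sconst 1.
Definition tser : ser R := fun n => if n == 1%N then 1 else 0.
Definition spow (f : ser R) (k : nat) : ser R := iter k (smul f) sone.
Definition ser_of_poly (p : {poly R}) : ser R := fun n => p`_n.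
Definition peval (p : {poly R}) (f : ser R) : ser R :=
  \big[sadd/szero]_(k < size p) smul (sconst p`_k) (spow f k).
End Series.

(** A series F in t with coefficients in R is algebraic (over R(t), i.e. over
    Q(t,x,y,w) for R = Q[x,y,w]): it is a root of a nonzero polynomial
    Q(T) with coefficients in R[t]. *)
Definition algebraic_ser (R : comNzRingType) (F : ser R) : Prop :=
  exists Q : {poly {poly R}}, Q != 0 /\
    forall n, (\big[@sadd R/@szero R]_(k < size Q)
                 smul (ser_of_poly Q`_k) (spow F k)) n = 0.

Definition vx : {mpoly rat[3]} := 'X_(inord 0).
Definition vy : {mpoly rat[3]} := 'X_(inord 1).
Definition vw : {mpoly rat[3]} := 'X_(inord 2).

Definition Gser : ser {mpoly rat[3]} := fun n =>
  \sum_(P : (2 * n).-tuple bool)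
   \sum_(Q : (2 * n).-tuple bool | is_interval P Q)
    \sum_(i < (2 * n).+1)
      vw ^+ `|height P i|%N * vx ^+ contact_lt P i * vy ^+ contact_ge P i.

(** G(1,1), coefficients in Q[w] = {poly rat} *)
Definition G11ser : ser {poly rat} := fun n =>
  \sum_(P : (2 * n).-tuple bool)
   \sum_(Q : (2 * n).-tuple bool | is_interval P Q)
    \sum_(i < (2 * n).+1) 'X ^+ `|height P i|%N.

Definition Cpoly : {poly {poly {poly rat}}} :=
  let h : {poly {poly {poly rat}}} := 'X in
  let z : {poly {poly {poly rat}}} := 'X%:P in
  let w : {poly {poly {poly rat}}} := ('X%:P)%:P in
  w * z * (-1 + z) ^+ 9 * h ^+ 3
  + (-1 + z) ^+ 6 * (2%:R * w ^+ 2 * z ^+ 2 - w ^+ 2 * z + 2%:R * z ^+ 2 + w - z) * h ^+ 2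
  - (-1 + z) ^+ 3 * (w ^+ 2 * z ^+ 3 - 3%:R * w ^+ 2 * z ^+ 2 - 2%:R * w * z ^+ 3
                     + w ^+ 2 * z - 2%:R * w * z ^+ 2 + z ^+ 3 + 5%:R * w * z
                     - 3%:R * z ^+ 2 - 2%:R * w + z) * h
  + 4%:R * w * z ^+ 2 - 4%:R * w * z + w.

Definition Ceval (h z : ser {poly rat}) : ser {poly rat} :=
  \big[@sadd _/@szero _]_(k < size Cpoly) smul (peval Cpoly`_k z) (spow h k).

(* Main.v *)
Require Import Defs.
From HB Require Import structures.
From mathcomp Require Import all_boot all_order all_algebra.
From mathcomp Require Import boolp zify ring mpoly.

(** Encoding Dyck paths as binary trees, P <= Q = u Q1 d Q2 holds iff
    P = u Pl d Pr P2 with Pl Pr <= Q1 and P2 <= Q2.  So an interval of positive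
    size is an interval with a marked contact of its lower path together with
    another interval.  Recording contacts (F) and a marked abscissa (G), this
    gives, with t marking the size,
      F(x) = x + t x F(x) (F(x) - F(1)) / (x - 1),
      G(x,y) = F(y) + t w x F(y) (G(1,y) - G(1,1)) / (y - 1) + x (F(y) - y) / y
               + t x^2 F(y) / y (G(x,y) - G(1,y)) / (x - 1)
               + t x (F(x) - F(1)) / (x - 1) (G(x,y) - F(y)).
    With t = z (1-z)^3 and x = (1+u)/(1+zu)^2, the first equation is solved by
    F(x) = (1+u)(1-2z-z^2 u) / ((1+zu)(1-z)^3).  The second one is linear: the
    series X with X - 1 = t X F(X) F(y) / y kills the coefficient of G(X,y) and
    leaves an equation between G(1,y) and G(1,1); then the series Y with
    Y - 1 = t w F(Y) F(X(Y)) kills the coefficient of G(1,Y), so that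
    G(1,1) = F(Y) + F(X) (F(Y)/Y - 1).  Everything is then rational in z and
    the parameter v of Y, and C(G(1,1),z,w) = 0 becomes a rational identity.
    Going back up, G(1,1), G(1,y) and G(x,y) are algebraic. *)

Set Implicit Arguments. Unset Strict Implicit. Unset Printing Implicit Defensive.
Import Order.TTheory GRing.Theory Num.Theory.

(** * Tamari intervals *)

Inductive dtree := Leaf | Node of dtree & dtree.

Fixpoint word (T : dtree) : seq bool :=
  if T is Node A B then true :: word A ++ false :: word B else [::].

Fixpoint tsize (T : dtree) : nat :=
  if T is Node A B then (tsize A + tsize B).+1 else 0.

Fixpoint tcat (T U : dtree) : dtree :=
  if T is Node A B then Node A (tcat B U) else U.

Lemma size_word T : size (word T) = (2 * tsize T)%N.
Proof. by elim: T => //= A IHA B IHB; rewrite size_cat /= IHA IHB; lia. Qed.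

Lemma count_word T : count id (word T) = tsize T.
Proof. by elim: T => //= A IHA B IHB; rewrite count_cat /= IHA IHB; lia. Qed.

Lemma word_tcat T U : word (tcat T U) = word T ++ word U.
Proof. by elim: T => //= A _ B ->; rewrite -catA. Qed.

Lemma tsize_tcat T U : tsize (tcat T U) = (tsize T + tsize U)%N.
Proof. by elim: T => //= A _ B ->; lia. Qed.

Lemma tcat_leaf T : tcat T Leaf = T.
Proof. by elim: T => //= A _ B ->. Qed.

Lemma tcatA T U V : tcat T (tcat U V) = tcat (tcat T U) V.
Proof. by elim: T => //= A _ B ->. Qed.

(** The down step after [word T] is the first one to go below the starting height, so it marks where
    the tree ends. Allowing a tail lets the induction pass through both subtrees. *)
Lemma word_cat_inj T U r s :
  word T ++ false :: r = word U ++ false :: s -> T = U /\ r = s.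
Proof.
elim: T U r s => [|A IHA B IHB] [|C D] r s //=; first by case.
case; rewrite -!catA => /IHA [-> ]; by case/IHB => -> ->.
Qed.

Lemma word_inj : injective word.
Proof.
move=> T U e; suff [] : T = U /\ [::] = [::] :> seq bool by [].
by apply: word_cat_inj; rewrite e.
Qed.

HB.instance Definition _ := Equality.copy dtree (inj_type word_inj).

(** * Heights along a word, parsing of Dyck words, and Tamari covers read on trees *)

Section Heights.
Local Open Scope ring_scope.


(* [h.-1] truncates at [0]: faithful only for paths that stay nonnegative. *)
Fixpoint path_heights (h : nat) (s : seq bool) : seq nat :=
  h :: (if s is b :: s' then path_heights (if b then h.+1 else h.-1) s' else [::]).


Lemma height0 s : height s 0 = 0.
Proof. by rewrite /height take0. Qed.

Lemma height_cons b s i : height (b :: s) i.+1 = (if b then 1 else -1) + height s i.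
Proof. by rewrite /height /=; case: b => /=; lia. Qed.

Lemma height_cat s r i : height (s ++ r) (size s + i) = height s (size s) + height r i.
Proof. by rewrite /height takeD take_cat drop_cat ltnn subnn take0 drop0 cats0 take_size !count_cat; lia. Qed.

Lemma height_catl s r i : (i <= size s)%N -> height (s ++ r) i = height s i.
Proof. by move=> le; rewrite /height takel_cat. Qed.

Lemma height_word_size T : height (word T) (size (word T)) = 0.
Proof.
rewrite /height take_size count_word.
have : (count id (word T) + count negb (word T) = size (word T))%N := count_predC id _.
rewrite count_word size_word; lia.
Qed.

Lemma height_word_ge0 T i : 0 <= height (word T) i.
Proof.
elim: T i => [|A IHA B IHB] i; first by rewrite /height; case: i.
case: i => [|i]; first by rewrite height0.
rewrite [word _]/= height_cons.
case: (leqP i (size (word A))) => lei; first by rewrite height_catl //; have := IHA i; lia.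
rewrite -(subnKC (ltnW lei)) height_cat height_word_size.
have : (0 < i - size (word A))%N by lia.
case: (i - size (word A))%N => // j _; rewrite height_cons; have := IHB j; lia.
Qed.

Lemma isDyck_word n T : isDyck n (word T) = (tsize T == n).
Proof.
rewrite /isDyck size_word count_word; apply/and3P/eqP => [[_ /eqP //]|<-].
by split=> //; apply/allP => i _; apply: height_word_ge0.
Qed.

(** A nonnegative path from height [h] to height 0 is read up to its first step below [h]; for
    [h = 0] there is no such step and the whole path is a tree. The induction is on the bound [m]
    because parsing resumes on a remainder that is not an immediate tail. *)
Lemma dyck_word (m : nat) (s : seq bool) (h : nat) :
  (size s <= m)%N -> (forall i, (i <= size s)%N -> 0 <= h%:Z + height s i) ->
  h%:Z + height s (size s) = 0 ->
  exists T, if h is h'.+1 then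
    exists r, [/\ s = word T ++ false :: r, 
      (forall i, (i <= size r)%N -> 0 <= h'%:Z + height r i)
      & h'%:Z + height r (size r) = 0] else s = word T.
Proof.
elim: m s h => [|m IH] [|b s] [|h] //= lesm hs hs0.
- by exists Leaf.
- by exists Leaf.
- case: b hs hs0 => hs hs0; last first.
    by have := hs 1%N isT; rewrite height_cons height0; lia.
  rewrite height_cons in hs0.
  case: (IH s 1%N) => // [i lei||A [r [es hr hr0]]].
  + by have := hs i.+1 lei; rewrite height_cons; lia.
  + by lia.
  case: (IH r 0%N) => //; first by move: lesm; rewrite es size_cat /=; lia.
  by move=> B er; exists (Node A B); rewrite es er.
- case: b hs hs0 => hs hs0; last first.
    exists Leaf, s; split=> // [i lei|]; last by move: hs0; rewrite height_cons; lia.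
    by have := hs i.+1 lei; rewrite height_cons; lia.
  rewrite height_cons in hs0.
  case: (IH s h.+2) => // [i lei||A [r [es hr hr0]]].
  + by have := hs i.+1 lei; rewrite height_cons; lia.
  + by lia.
  case: (IH r h.+1) => //; first by move: lesm; rewrite es size_cat /=; lia.
  move=> B [r' [er hr' hr'0]]; exists (Node A B), r'; split=> //.
  by rewrite es er /= -catA.
Qed.

Lemma isDyckP n s : reflect (exists2 T, tsize T = n & s = word T) (isDyck n s).
Proof.
apply: (iffP idP) => [|[T <- ->]]; last by rewrite isDyck_word.
case/and3P=> /eqP ss /eqP cs /allP hs.
have hs0 : height s (size s) = 0.
  have e : (count id s + count negb s = size s)%N := count_predC id s.
  by rewrite /height take_size; lia.
case: (@dyck_word (size s) s 0 (leqnn _)) => [i lei||T es].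
- by rewrite add0r; apply: hs; rewrite mem_iota.
- by rewrite add0r.
by exists T; rewrite // -count_word -es.
Qed.

Lemma path_heightsE s h i : (forall j, (j <= size s)%N -> 0 <= h%:Z + height s j) ->
  (i <= size s)%N -> (nth 0%N (path_heights h s) i)%:Z = h%:Z + height s i.
Proof.
elim: s h i => [|b s IH] h [|i] //= hs lei; rewrite ?height0 ?addr0 //.
rewrite height_cons; have h1 := hs 1%N isT; rewrite height_cons height0 in h1.
rewrite IH // => [|j lej]; first by case: b {hs} h1; lia.
by have := hs j.+1 lej; rewrite height_cons; case: b {hs} h1; lia.
Qed.

Lemma size_path_heights h s : size (path_heights h s) = (size s).+1.
Proof. by elim: s h => //= b s IH h; rewrite IH. Qed.

Lemma path_heights_word T : path_heights 0 (word T) = [seq `|height (word T) i|%N | i <- iota 0 (size (word T)).+1].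
Proof.
apply: (@eq_from_nth _ 0%N); rewrite size_path_heights ?size_map ?size_iota // => i lei.
have ge0 := height_word_ge0 T.
rewrite (nth_map 0%N) ?size_iota // nth_iota //.
have h0 j : (j <= size (word T))%N -> 0 <= 0%:Z + height (word T) j by rewrite add0r.
by rewrite -[height _ _]add0r -(path_heightsE h0).
Qed.

(* Tamari covers: [Node A B] encodes the path [u A d B], and [Rot0] exchanges
   that [d] with the excursion [u B d] which follows it. *)
Inductive trot : dtree -> dtree -> Prop :=
| RotL A A' B : trot A A' -> trot (Node A B) (Node A' B)
| RotR A B B' : trot B B' -> trot (Node A B) (Node A B')
| Rot0 A B C : trot (Node A (Node B C)) (Node (tcat A (Node B Leaf)) C).

(** [word A] never goes below its starting height, so u A d comes back to its level only with its
    last step. The 3 counts the initial d, the u and the closing d. *)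
Lemma excursion_end_word l A r :
  excursion_end (l ++ false :: true :: word A ++ false :: r) (size l) = (size l + size (word A) + 3)%N.
Proof.
rewrite /excursion_end.
set s := l ++ _; set P := fun j => _.
have hP j : P ((size l).+2 + j)%N = (1 + height (word A ++ false :: r) j == 0).
  rewrite /P (_ : (size l).+2 + j = size l + j.+2)%N; last by lia.
  rewrite (_ : (size l).+1 = size l + 1)%N; last by lia.
  by rewrite /s !height_cat !height_cons height0; lia.
have -> : find P (iota (size l).+2 (size s - (size l).+1)) = (size (word A)).+1; last by lia.
have ss : (size s - (size l).+1 = (size (word A)).+1 + (size r).+1)%N.
  by rewrite /s size_cat /= size_cat /=; lia.
rewrite ss iotaD find_cat.
case: ifP => [/hasP [j]|_].
  rewrite mem_iota => /andP[lej ltj]; rewrite -(subnKC lej) hP height_catl; last by lia.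
  by have := height_word_ge0 A (j - (size l).+2); lia.
rewrite size_iota [iota _ (size r).+1]/= [find _ _]/= hP.
by rewrite -(addn1 (size (word A))) height_cat height_word_size height_cons height0 /=; lia.
Qed.

Lemma tamari_move_word l A r :
  tamari_move (l ++ false :: true :: word A ++ false :: r) (size l) =
  l ++ true :: word A ++ false :: false :: r.
Proof.
rewrite /tamari_move excursion_end_word -addnA takeD take_size_cat //.
set s := l ++ false :: true :: _.
have -> : drop (size l + (size (word A) + 3)) s = r.
  by rewrite /s drop_cat ltnNge leq_addr /= addKn addn3 /= drop_cat ltnNge leqnSn /= subSnn /= drop0.
rewrite /s (@drop_size_cat _ (size l)) // drop_cat ltnNge leqnSn /= subSnn.
have -> : take (size (word A) + 3) (false :: true :: word A ++ false :: r)
   = false :: true :: word A ++ [:: false].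
  by rewrite addn3 /= take_cat ltnNge leqnSn /= subSnn /= take0.
by rewrite /= -catA.
Qed.

Lemma trot_word T T' : trot T T' -> exists l A r,
  word T = l ++ false :: true :: word A ++ false :: r /\
  word T' = l ++ true :: word A ++ false :: false :: r.
Proof.
elim=> {T T'} /= [A A' B _ [l [C [r [-> ->]]]]|A B B' _ [l [C [r [-> ->]]]]|A B C].
- by exists (true :: l), C, (r ++ false :: word B); rewrite /= -!catA /= -!catA /=.
- by exists (true :: word A ++ false :: l), C, r; rewrite /= -!catA.
- by exists (true :: word A), B, (word C); rewrite word_tcat /= -!catA /= -!catA.
Qed.

(** In u A d B, a down step followed by an up step lies inside A, or is the d after A followed by
    the first step of B, or lies inside B. The three cases of [key] give [RotL], [Rot0] and
    [RotR]. *)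
Lemma word_trot T l q : word T = l ++ false :: true :: q -> exists A r T',
  [/\ q = word A ++ false :: r, trot T T' & word T' = l ++ true :: word A ++ false :: false :: r].
Proof.
elim: T l q => [|A IHA B IHB] [|b l] q //=; case=> <- e.
have key : (exists q', q = q' ++ false :: word B /\ word A = l ++ false :: true :: q')
  \/ (l = word A /\ word B = true :: q)
  \/ (exists l', l = word A ++ false :: l' /\ word B = l' ++ false :: true :: q).
  have := congr1 (drop (size (word A))) e; have := congr1 (take (size (word A))) e.
  rewrite take_size_cat // drop_size_cat //.
  case: (ltngtP (size (word A)) (size l)) => [lt|lt|eqs].
  - rewrite takel_cat ?(ltnW lt)// drop_cat lt => eA eB; right; right.
    have := size_drop (size (word A)) l; case: (drop _ l) (cat_take_drop (size (word A)) l) eB => [|b' l'] /=; first by lia.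
    by move=> <-; rewrite -eA => -[<- ->]; exists l'.
  - rewrite take_cat drop_cat !ltnNge (ltnW lt) /=.
    have [j ->] : exists j, (size (word A) - size l = j.+1)%N by exists (size (word A) - (size l).+1)%N; lia.
    case: j => [|j] /= eA eB; last first.
      by left; exists (take j q); split=> //; rewrite -[LHS](cat_take_drop j) -eB.
    by case: eB.
  - by rewrite eqs take_size_cat // drop_size_cat // => <- [->]; right; left.
case: key => [[q' [eq eA]]|[[el eB]|[l' [el eB]]]].
- have [C [r [A' [e1 e2 e3]]]] := IHA _ _ eA.
  exists C, (r ++ false :: word B), (Node A' B); split; [|by constructor|].
    by rewrite eq e1 -catA.
  by rewrite /= e3 /= -!catA /= -!catA.
- case: B eB {IHB e} => //= C D [<-].
  by exists C, (word D), (Node (tcat A (Node C Leaf)) D); split=> //;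
    [exact: Rot0 | rewrite /= word_tcat el /= -!catA /= -!catA].
- have [C [r [B' [e1 e2 e3]]]] := IHB _ _ eB.
  exists C, r, (Node A B'); split=> //; first by constructor.
  by rewrite /= e3 el -catA.
Qed.

Lemma tamari_coverP n (p q : (2 * n).-tuple bool) T : val p = word T ->
  reflect (exists2 T', trot T T' & val q = word T') (tamari_cover p q).
Proof.
move=> ep.
have szT : (2 * n = size (word T))%N by rewrite -ep size_tuple.
have tn : tsize T = n by move: szT; rewrite size_word; lia.
apply: (iffP idP) => [|[T' rT eq]].
  case/andP=> _ /existsP[k /andP[/andP[]]]; rewrite ep => k0 k1 /eqP ->.
  have ltk : (k < size (word T))%N by rewrite -szT.
  have ltk1 : (k.+1 < size (word T))%N.
    by rewrite ltnNge; apply/negP => le; rewrite nth_default in k1.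
  have e : word T = take k (word T) ++ false :: true :: drop k.+2 (word T).
    rewrite -{1}(cat_take_drop k (word T)) (drop_nth true) // (drop_nth false) //.
    by rewrite (eqP k0) (eqP k1).
  have [A [r [T' [e1 e2 e3]]]] := word_trot e.
  exists T' => //; rewrite e3 e e1.
  rewrite -{2}(size_takel (ltnW ltk)) tamari_move_word.
  by rewrite take_size_cat ?size_takel // ltnW.
have [l [A [r [e1 e2]]]] := trot_word rT.
rewrite /tamari_cover ep isDyck_word tn eqxx /=.
have ltk : (size l < 2 * n)%N by rewrite szT e1 size_cat /=; lia.
apply/existsP; exists (Ordinal ltk); rewrite /= e1 tamari_move_word eq e2 eqxx andbT.
rewrite /tamari_move_ok nth_cat ltnn subnn /= nth_cat.
by rewrite ltnNge leqnSn /= subSnn.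
Qed.

Lemma trot_tsize T T' : trot T T' -> tsize T = tsize T'.
Proof. by elim=> {T T'} /=; move=> *; rewrite ?tsize_tcat /=; lia. Qed.

(** * The Tamari order by recursion on the upper path *)

Inductive trots : dtree -> dtree -> Prop :=
| Rots0 T : trots T T
| RotsS T U V : trot T U -> trots U V -> trots T V.

Lemma trots_trans T U V : trots T U -> trots U V -> trots T V.
Proof. by elim=> {T U} // T U W r _ IH /IH; apply: RotsS. Qed.

Lemma trotsL A A' B : trots A A' -> trots (Node A B) (Node A' B).
Proof. by elim=> {A A'} [A|A A1 A2 r _ IH]; [constructor|apply: RotsS IH; constructor]. Qed.

Lemma trotsR A B B' : trots B B' -> trots (Node A B) (Node A B').
Proof. by elim=> {B B'} [B|B B1 B2 r _ IH]; [constructor|apply: RotsS IH; constructor]. Qed.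

(* The first return of [Q] cuts [P] into [u Pl d Pr P2]: the recursive
   decomposition of Tamari intervals (Bousquet-Melou, Fusy, Preville-Ratelle). *)
Fixpoint tle (P Q : dtree) : Prop :=
  if Q is Node Q1 Q2 then
    exists Pl Pr P2, [/\ P = Node Pl (tcat Pr P2), tle (tcat Pl Pr) Q1 & tle P2 Q2]
  else P = Leaf.

Lemma tle_refl T : tle T T.
Proof. by elim: T => //= A IHA B IHB; exists A, Leaf, B; rewrite tcat_leaf. Qed.

Lemma trot_tcat A A' B : trot A A' -> trot (tcat A B) (tcat A' B).
Proof.
by elim=> {A A'} /= [A A' C r _|A C C' _ IH|A C D]; constructor.
Qed.

(** A cover only raises the path, so the contact between [C1] and [C2] was already a contact before
    the move, and the move takes place on one side of it. *)
Lemma trot_tcat_inv B C1 C2 : trot B (tcat C1 C2) ->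
  (exists2 B1, B = tcat B1 C2 & trot B1 C1) \/ (exists2 B2, B = tcat C1 B2 & trot B2 C2).
Proof.
elim: C1 B => [|D _ E IH] B /= r; first by right; exists B.
inversion r as [A A' B' rA eB|A B' B'' rB eB|A B' C' eB]; subst.
- by left; exists (Node A E) => //; constructor.
- case: (IH _ rB) => [[B1 -> rB1]|[B2 -> rB2]]; last by right; exists B2.
  by left; exists (Node D B1) => //; constructor.
- by left; exists (Node A (Node B' E)) => //; constructor.
Qed.

(** A move in the first excursion acts on [Pl], and one in the rest acts on [Pr] or on [P2]. Undoing
    a move of the first return itself adds one arch in front of [Pr]. *)
Lemma trot_tle P P' Q : trot P P' -> tle P' Q -> tle P Q.
Proof.
elim: Q P P' => [|Q1 IH1 Q2 IH2] P P' r /=; first by move=> eP'; rewrite eP' in r; inversion r.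
case=> [Pl [Pr [P2 [eP' le1 le2]]]]; rewrite {}eP' in r.
inversion r as [A A' B' rA eB|A B' B'' rB eB|A B' C' eB]; subst.
- by exists A, Pr, P2; split=> //; apply: IH1 le1; apply: trot_tcat.
- case: (trot_tcat_inv rB) => [[B1 -> rB1]|[B2 -> rB2]].
    exists Pl, B1, P2; split=> //; apply: IH1 le1.
    by elim: (Pl) => //= X _ Y HY; constructor.
  by exists Pl, Pr, B2; split=> //; apply: IH2 le2.
- by exists A, (Node B' Pr), P2; split=> //; move: le1; rewrite -tcatA.
Qed.

(** The first return is moved past the arches of [Pr] one at a time. *)
Lemma trots_absorb Pl Pr P2 : trots (Node Pl (tcat Pr P2)) (Node (tcat Pl Pr) P2).
Proof.
elim: Pr Pl => [|A _ B IH] Pl /=; first by rewrite tcat_leaf; constructor.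
apply: RotsS; first exact: Rot0.
by rewrite [tcat Pl (Node A B)](_ : _ = tcat (tcat Pl (Node A Leaf)) B) // -tcatA.
Qed.

Lemma tle_trots P Q : tle P Q -> trots P Q.
Proof.
elim: Q P => [|Q1 IH1 Q2 IH2] P /=; first by move->; constructor.
move=> [Pl [Pr [P2 [-> /IH1 r1 /IH2 r2]]]].
apply: trots_trans (trots_absorb _ _ _) _.
exact: trots_trans (trotsL _ r1) (trotsR _ r2).
Qed.

(** A chain of covers turns into [tle] by absorbing its steps from the last to the first
    ([trot_tle]), starting from reflexivity; conversely [tle] unfolds into a chain ([tle_trots]). *)
Lemma is_intervalP n (p q : (2 * n).-tuple bool) :
  reflect (exists P Q, [/\ tsize P = n, val p = word P, val q = word Q & tle P Q])
          (is_interval p q).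
Proof.
apply: (iffP and3P) => [[/isDyckP[P sP eP] /isDyckP[Q sQ eQ] /connectP[s]]|].
  elim: s p P sP eP => [|r s IH] p P sP eP /=.
    by move=> _ epq; exists P, P; rewrite epq; split=> //; apply: tle_refl.
  case/andP=> /(tamari_coverP _ eP)[P' rP eP'] path_s last_s.
  have sP' : tsize P' = n by rewrite -(trot_tsize rP).
  have [P1 [Q1 [_ e1 e2 le1]]] := IH _ _ sP' eP' path_s last_s.
  exists P, Q1; split=> //; apply: trot_tle rP _.
  by rewrite (_ : P' = P1) //; apply: word_inj; rewrite -eP'.
move=> [P [Q [sP eP eQ /tle_trots r]]].
have tPQ : tsize P = tsize Q by elim: r {sP eP eQ} => // T U V /trot_tsize -> _ ->.
split; [by rewrite eP isDyck_word sP|by rewrite eQ isDyck_word -tPQ sP|].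
elim: r p sP eP eQ {tPQ} => {P Q} [P|P P' Q rP _ IH] p sP eP eQ.
  have -> : p = q by apply: val_inj; rewrite eP eQ.
  exact: connect0.
have sz : size (word P') == (2 * n)%N by rewrite size_word -(trot_tsize rP) sP.
apply: (@connect_trans _ _ (Tuple sz)); last by apply: IH => //; rewrite -(trot_tsize rP).
by apply: connect1; apply/(tamari_coverP _ eP); exists P'.
Qed.

End Heights.

(** * Enumeration of the intervals of each size *)

Fixpoint splits (T : dtree) : seq (dtree * dtree) :=
  if T is Node A B then
    (Leaf, T) :: [seq (Node A s.1, s.2) | s <- splits B]
  else [:: (Leaf, Leaf)].

Lemma mem_splits T s : (s \in splits T) = (tcat s.1 s.2 == T).
Proof.
elim: T s => [|A _ B IH] [l r] /=.
  by rewrite inE xpair_eqE; case: l => [|A B].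
rewrite inE; case: l => [|C l] /=.
  rewrite xpair_eqE eqxx /= orbC; case: mapP => //; by case=> s _ [].
apply/mapP/eqP => [[[l' r'] ins [-> -> ->]]|[-> e]].
  by move: ins; rewrite IH => /eqP ->.
by exists (l, r) => //; rewrite IH e.
Qed.

Lemma uniq_splits T : uniq (splits T).
Proof.
elim: T => //= A _ B IH; apply/andP; split; first by apply/mapP; case=> s _ [].
by rewrite map_inj_uniq // => -[l r] [l' r'] [-> ->].
Qed.

(** Inverse of the decomposition in [tle]. The tuple holds the size of the first interval [K], [K]
    itself, the second interval [J], and a cut [s] of the lower path of [K] at its marked
    contact. *)
Definition glue (q : nat * (dtree * dtree) * (dtree * dtree) * (dtree * dtree)) :=
  let: (_, K, J, s) := q in (Node s.1 (tcat s.2 J.1), Node K.2 J.2).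

Definition glue_data (L : nat -> seq (dtree * dtree)) n :=
  [seq (q, s) | q <- [seq (kI, J) | kI <- [seq (k, K) | k <- iota 0 n.+1, K <- L k],
                                    J <- L (n - kI.1)],
                s <- splits q.1.2.1].

(* [f] is fuel; for [n <= f] the list does not depend on it, up to permutation. *)
Fixpoint intervals_fuel (f n : nat) : seq (dtree * dtree) :=
  match n, f with
  | 0, _ => [:: (Leaf, Leaf)]
  | n'.+1, f'.+1 => [seq glue q | q <- glue_data (intervals_fuel f') n']
  | _, 0 => [::]
  end.

Definition intervals n := intervals_fuel n n.

Lemma mem_glue_data L n k K J s : ((k, K, J, s) \in glue_data L n) =
  [&& k <= n, K \in L k, J \in L (n - k)%N & tcat s.1 s.2 == K.1].
Proof.
apply/allpairsPdep/and4P => [[q [s' [/allpairsPdep[kI [J' [/allpairsPdep[k' [K' [ink inK ->]]] inJ ->]]] ins [-> -> -> ->]]]]|[lek inI inJ es]].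
  by move: ink ins; rewrite mem_iota mem_splits.
exists (k, K, J), s; split=> //; last by rewrite mem_splits.
apply/allpairsPdep; exists (k, K), J; split=> //.
by apply/allpairsPdep; exists k, K; rewrite mem_iota.
Qed.

Lemma uniq_pairs (S T : eqType) (s : seq S) (t : S -> seq T) :
  uniq s -> {in s, forall x, uniq (t x)} -> uniq [seq (x, y) | x <- s, y <- t x].
Proof. by move=> us ut; apply: allpairs_uniq_dep => // -[x y] [x' y'] _ _ /= [-> ->]. Qed.

Lemma uniq_glue_data L n : (forall k, k <= n -> uniq (L k)) -> uniq (glue_data L n).
Proof.
move=> uL; apply: uniq_pairs; last by move=> q _; apply: uniq_splits.
apply: uniq_pairs; last by move=> q _; apply: uL; apply: leq_subr.
by apply: uniq_pairs => [|k]; rewrite ?iota_uniq // mem_iota => /uL.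
Qed.

Lemma tle_tsize P Q : tle P Q -> tsize P = tsize Q.
Proof.
elim: Q P => [|Q1 IH1 Q2 IH2] P /=; first by move->.
by case=> Pl [Pr [P2 [-> /IH1 <- /IH2 <-]]] /=; rewrite !tsize_tcat; lia.
Qed.

Lemma tcat_inj A B C D : tsize A = tsize C -> tcat A B = tcat C D -> A = C /\ B = D.
Proof.
elim: A C B D => [|A1 _ A2 IH] [|C1 C2] B D //= [].
by move=> e [e1]; move: e; rewrite e1 => /addnI /IH H /H [-> ->].
Qed.

(** Gluing is injective: the upper tree gives back both upper factors, hence the size [k], and equal
    sizes then locate the boundary between [s.2] and the lower path of [J]. *)
Lemma intervals_fuelP f n : n <= f ->
  uniq (intervals_fuel f n) /\
  forall P Q, (P, Q) \in intervals_fuel f n <-> tsize P = n /\ tle P Q.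
Proof.
elim: f n => [|f IH] [|n] //= lenf.
- by split=> // -[|A B] [|C D]; rewrite inE //=; split=> // -[] // _ [? [? [? []]]].
- by split=> // -[|A B] [|C D]; rewrite inE //=; split=> // -[] // _ [? [? [? []]]].
have IHu k : k <= n -> uniq (intervals_fuel f k).
  by move=> le; case: (IH k) => //; apply: leq_trans le lenf.
have IHm k P Q : k <= n -> (P, Q) \in intervals_fuel f k <-> tsize P = k /\ tle P Q.
  by move=> le; case: (IH k) => //; apply: leq_trans le lenf.
split.
  rewrite map_inj_in_uniq ?uniq_glue_data //.
  move=> [[[k [P Q]] [P2 Q2]] [l r]] [[[k' [P' Q']] [P2' Q2']] [l' r']].
  rewrite !mem_glue_data /= => /and4P[lek /IHm H1 /IHm H2 /eqP e] /and4P[lek' /IHm H1' /IHm H2' /eqP e'].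
  case: (H1 lek) => sP leP; case: (H1' lek') => sP' leP'.
  case: (H2 (leq_subr _ _)) => sP2 leP2; case: (H2' (leq_subr _ _)) => sP2' leP2'.
  case=> el er eQ eQ2.
  have ek : k = k' by rewrite -sP -sP' (tle_tsize leP) (tle_tsize leP') eQ.
  have /tcat_inj : tsize r = tsize r'.
    move: sP sP'; rewrite -e -e' !tsize_tcat el ek; lia.
  by move=> H; case/H: er => er eP2; rewrite ek -e -e' el er eQ eQ2 eP2.
move=> P Q; split.
  case/mapP=> -[[[k [P1 Q1]] [P2 Q2]] [l r]].
  rewrite !mem_glue_data /= => /and4P[lek /IHm H1 /IHm H2 /eqP e] [-> ->].
  case: (H1 lek) => sP leP; case: (H2 (leq_subr _ _)) => sP2 leP2.
  split; last by exists l, r, P2; rewrite e.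
  by rewrite /= tsize_tcat sP2; move: sP; rewrite -e tsize_tcat; lia.
case: Q => [|Q1 Q2] [] sP /=; first by move=> eP; move: sP; rewrite eP.
case=> [l [r [P2 [eP le1 le2]]]].
pose k := tsize Q1; have sQ1 := tle_tsize le1; rewrite tsize_tcat in sQ1.
move: sP; rewrite eP /= tsize_tcat => -[sP].
apply/mapP; exists (k, (tcat l r, Q1), (P2, Q2), (l, r)) => //.
rewrite mem_glue_data eqxx andbT /=; apply/and3P; split; first by rewrite /k; lia.
  by apply/IHm; rewrite ?tsize_tcat /k; [lia|split].
by apply/IHm; rewrite ?leq_subr // /k; split=> //; lia.
Qed.

Lemma intervals_uniq n : uniq (intervals n).
Proof. by case: (intervals_fuelP (leqnn n)). Qed.

Lemma mem_intervals n P Q : (P, Q) \in intervals n <-> tsize P = n /\ tle P Q.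
Proof. by case: (intervals_fuelP (leqnn n)). Qed.

Lemma perm_intervals f n : n <= f -> perm_eq (intervals_fuel f n) (intervals n).
Proof.
move=> le; have [u m] := intervals_fuelP le.
apply: uniq_perm => //; first exact: intervals_uniq.
by move=> [P Q]; apply/idP/idP => [/m /mem_intervals //|/mem_intervals /m].
Qed.

Local Open Scope ring_scope.

(** * Recurrences for the coefficients of $F$ and $G$ *)

Section Sums.
Variable B : comNzRingType.

Lemma sum_is_interval n (phi : seq bool -> B) :
  \sum_(P : (2 * n).-tuple bool) \sum_(Q : (2 * n).-tuple bool | is_interval P Q) phi P
  = \sum_(I <- intervals n) phi (word I.1).
Proof.
rewrite pair_big_dep /=.
pose f (I : dtree * dtree) := (word I.1, word I.2).
pose g (pq : (2 * n).-tuple bool * (2 * n).-tuple bool) := (val pq.1, val pq.2).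
transitivity (\sum_(s <- map g (filter (fun pq => is_interval pq.1 pq.2) (index_enum _))) phi s.1).
  by rewrite big_map big_filter.
transitivity (\sum_(s <- map f (intervals n)) phi s.1); last by rewrite big_map.
apply: perm_big; apply: uniq_perm.
- rewrite map_inj_uniq ?filter_uniq ?index_enum_uniq //.
  by move=> [p q] [p' q'] [/val_inj -> /val_inj ->].
- rewrite map_inj_uniq ?intervals_uniq // => -[P Q] [P' Q'] [].
  by move=> /word_inj -> /word_inj ->.
move=> s; apply/mapP/mapP => [[[p q]]|[[P Q] /mem_intervals[sP le] ->]].
  rewrite mem_filter => /andP[/is_intervalP[P [Q [sP eP eQ le]]] _] ->.
  by exists (P, Q); rewrite /g /f /= ?eP ?eQ //; apply/mem_intervals.
have tP : size (word P) == (2 * n)%N by rewrite size_word sP.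
have tQ : size (word Q) == (2 * n)%N by rewrite size_word -(tle_tsize le) sP.
exists (Tuple tP, Tuple tQ) => //; rewrite mem_filter mem_index_enum andbT.
by apply/is_intervalP; exists P, Q.
Qed.

Lemma sum_intervalsS n (phi : dtree -> B) :
  \sum_(I <- intervals n.+1) phi I.1 =
  \sum_(k < n.+1) \sum_(I <- intervals k) \sum_(J <- intervals (n - k))
     \sum_(s <- splits I.1) phi (Node s.1 (tcat s.2 J.1)).
Proof.
rewrite /intervals /= big_map /glue_data !big_allpairs_dep /=.
rewrite -[0%N :: iota 1 n]/(index_iota 0 n.+1) big_mkord.
apply: eq_bigr => k _.
rewrite (perm_big _ (perm_intervals (leq_ord k))); apply: eq_bigr => I _.
by rewrite (perm_big _ (perm_intervals (leq_subr k n))).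
Qed.

(* The last vertex of the path is omitted, so that these lists concatenate. *)
Fixpoint inner_heights (h : nat) (T : dtree) : seq nat :=
  if T is Node A B then h :: inner_heights h.+1 A ++ h.+1 :: inner_heights h B else [::].

Definition heights T := rcons (inner_heights 0 T) 0%N.

Lemma path_heights_cat h T r : path_heights h (word T ++ r) = inner_heights h T ++ path_heights h r.
Proof.
elim: T h r => //= A IHA C IHC h r.
by rewrite -!catA IHA /= IHC.
Qed.

Lemma heights_word T : path_heights 0 (word T) = heights T.
Proof. by rewrite -[word T]cats0 path_heights_cat cats1. Qed.

Lemma inner_heightsS h T : inner_heights h.+1 T = map S (inner_heights h T).
Proof. by elim: T h => //= A IHA C IHC h; rewrite map_cat /= IHA IHC. Qed.

Lemma inner_heights_cat h T U : inner_heights h (tcat T U) = inner_heights h T ++ inner_heights h U.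
Proof. by elim: T h => //= A IHA C IHC h; rewrite IHC -catA. Qed.

Lemma heights_glue l r J : heights (Node l (tcat r J)) = (0%N :: map S (heights l)) ++ inner_heights 0 r ++ heights J.
Proof. by rewrite /heights /= inner_heights_cat inner_heightsS map_rcons -!cats1 /= -!catA /= -?catA. Qed.

Definition contacts (s : seq nat) := count (pred1 0%N) s.

Variable w : B.
Implicit Types x y a b : B.

(** Sum over the marked vertex of a list of heights. Either the head is marked, and each contact
    from it on counts [y], or the head lies before the mark and counts [x] if it is a contact. *)
Fixpoint weight (x y : B) (s : seq nat) : B :=
  if s is h :: s' then w ^+ h * y ^+ contacts s + x ^+ (h == 0%N) * weight x y s' else 0.

Lemma weight_sum x y s : weight x y s =
  \sum_(i < size s) w ^+ nth 0%N s i * x ^+ contacts (take i s) * y ^+ contacts (drop i s).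
Proof.
elim: s => [|h s IH]; first by rewrite big_ord0.
rewrite big_ord_recl /= mulr1 IH mulr_sumr; congr (_ + _).
by apply: eq_bigr => i _; rewrite /= exprD; ring.
Qed.

Lemma weight_cat a b s r :
  weight a b (s ++ r) = weight a b s * b ^+ contacts r + a ^+ contacts s * weight a b r.
Proof.
elim: s => [|h s IH] /=; first by rewrite mul0r mul1r add0r.
by rewrite IH /contacts count_cat !exprD; ring.
Qed.

Lemma contacts_mapS s : contacts (map S s) = 0%N.
Proof. by elim: s. Qed.

(** Raised vertices are no contacts, so [a] and [b] disappear, and each marked height gains one
    factor [w]. *)
Lemma weight_mapS a b s : weight a b (map S s) = w * weight 1 1 s.
Proof.
elim: s => [|h s IH] /=; first by rewrite mulr0.
by rewrite IH -/(contacts _) contacts_mapS !expr1n exprS; ring.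
Qed.

Lemma contacts_heights T : contacts (heights T) = (contacts (inner_heights 0 T)).+1.
Proof. by rewrite /heights /contacts -cats1 count_cat /= addn1. Qed.

Lemma contacts_inner_heights A T : contacts (inner_heights 0 (Node A T)) = (contacts (inner_heights 0 T)).+1.
Proof. by rewrite /contacts /= count_cat /= inner_heightsS -/(contacts _) contacts_mapS. Qed.

Lemma heightsN A T : heights (Node A T) = (0%N :: map S (heights A)) ++ heights T.
Proof. exact: (heights_glue A Leaf T). Qed.

Lemma weight_head a b A :
  weight a b (0%N :: map S (heights A)) = b + a * w * weight 1 1 (heights A).
Proof.
by rewrite /= weight_mapS -/(contacts _) contacts_mapS expr0 mul1r expr1 expr1; ring.
Qed.

Lemma contacts_head A : contacts (0%N :: map S (heights A)) = 1%N.
Proof. by rewrite /contacts /= -/(contacts _) contacts_mapS. Qed.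

Lemma weight_N a b A T : weight a b (heights (Node A T)) =
  (b + a * w * weight 1 1 (heights A)) * b ^+ contacts (heights T) + a * weight a b (heights T).
Proof. by rewrite heightsN weight_cat weight_head contacts_head expr1. Qed.

Lemma weight_leaf a b : weight a b (heights Leaf) = b.
Proof. by rewrite /= /contacts /= expr0 expr1 mulr0 addr0 mul1r. Qed.

Lemma big_splitsN (F : dtree -> dtree -> B) A T :
  \sum_(s <- splits (Node A T)) F s.1 s.2 =
  F Leaf (Node A T) + \sum_(s <- splits T) F (Node A s.1) s.2.
Proof. by rewrite big_cons big_map. Qed.

(** Geometric sum: as the cut runs over the contacts of [T], the exponent takes each value from 0 to
    one less than the number of contacts. This is the source of the divided differences. *)
Lemma sum_splits_contacts y T :
  (y - 1) * \sum_(s <- splits T) y ^+ contacts (inner_heights 0 s.2) = y ^+ contacts (heights T) - 1.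
Proof.
rewrite contacts_heights; elim: T => [|A _ T IH]; first by rewrite /= big_seq1 /= mulr1 expr1.
rewrite (big_splitsN (fun _ r => y ^+ contacts (inner_heights 0 r))) mulrDr IH contacts_inner_heights !exprS; ring.
Qed.

(** Exchange the cut and the mark. If $j$ contacts lie at or after a marked vertex, then $j$ cuts
    leave it in the left part, with exponents $0,\dots,j-1$, and $(y-1)(1+\dots+y^{j-1})=y^j-1$. *)
Lemma sum_splits_weight_left y T :
  (y - 1) * \sum_(s <- splits T) weight 1 1 (heights s.1) * y ^+ contacts (inner_heights 0 s.2)
  = weight 1 y (heights T) - weight 1 1 (heights T).
Proof.
elim: T => [|A _ T IH]; first by rewrite big_seq1 !weight_leaf [contacts _]/= expr0; ring.
rewrite (big_splitsN (fun l r => weight 1 1 (heights l) * y ^+ contacts (inner_heights 0 r))).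
have -> : \sum_(s <- splits T) weight 1 1 (heights (Node A s.1)) * y ^+ contacts (inner_heights 0 s.2)
  = (1 + w * weight 1 1 (heights A)) * (\sum_(s <- splits T) y ^+ contacts (inner_heights 0 s.2))
  + \sum_(s <- splits T) weight 1 1 (heights s.1) * y ^+ contacts (inner_heights 0 s.2).
  rewrite mulr_sumr -big_split; apply: eq_bigr => s _.
  by rewrite weight_N expr1n [RHS]/=; ring.
rewrite !mulrDr [X in _ + (X + _)]mulrCA sum_splits_contacts IH !weight_N weight_leaf.
by rewrite contacts_inner_heights contacts_heights expr1n !exprS; ring.
Qed.

(** If $a$ contacts precede a marked vertex, the cuts at these contacts give $x+\dots+x^a$, whence
    the first term. The last term collects the marks placed on the cut itself. *)
Lemma sum_splits_weight_right x y T :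
  (x - 1) * \sum_(s <- splits T) weight x y (heights s.2)
  = x * (weight x y (heights T) - weight 1 y (heights T))
    + (x - 1) * (y * \sum_(s <- splits T) y ^+ contacts (inner_heights 0 s.2)).
Proof.
elim: T => [|A _ T IH]; first by rewrite !big_seq1 !weight_leaf expr0; ring.
rewrite (big_splitsN (fun _ r => weight x y (heights r))).
rewrite (big_splitsN (fun _ r => y ^+ contacts (inner_heights 0 r))).
rewrite mulrDr IH !weight_N contacts_inner_heights contacts_heights !exprS; ring.
Qed.

Lemma sum_splits_weight x y T J :
  (x - 1) * (y - 1) * y * (\sum_(s <- splits T) weight x y (heights (Node s.1 (tcat s.2 J)))) =
  ((x - 1) * y * (y + x) * (y ^+ contacts (heights T) - 1)
   + y * x * w * (x - 1) * (weight 1 y (heights T) - weight 1 1 (heights T))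
   + x ^+ 2 * (y - 1) * (weight x y (heights T) - weight 1 y (heights T))
   - x * y * (y - 1) * (x ^+ contacts (heights T) - 1)) * y ^+ contacts (heights J)
  + x * y * (y - 1) * (x ^+ contacts (heights T) - 1) * weight x y (heights J).
Proof.
pose S1 (a : B) := \sum_(s <- splits T) a ^+ contacts (inner_heights 0 s.2).
pose S2 := \sum_(s <- splits T) weight 1 1 (heights s.1) * y ^+ contacts (inner_heights 0 s.2).
pose S3 := \sum_(s <- splits T) weight x y (heights s.2).
(* The four terms correspond to a mark on the initial vertex, in the raised [s.1], in [s.2] without
   its last vertex, and in [J]. The extra factor [y] compensates for the vertex shared by [s.2] and
   [J], which [S3] counts with [s.2]. *)
have -> : (x - 1) * (y - 1) * y * (\sum_(s <- splits T) weight x y (heights (Node s.1 (tcat s.2 J))))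
  = (x - 1) * (y - 1) * ((y ^+ 2 * S1 y + y * x * w * S2 + x * (S3 - y * S1 x)) * y ^+ contacts (heights J)
     + x * y * S1 x * weight x y (heights J)).
  transitivity ((x - 1) * (y - 1) * (y ^+ 2 * y ^+ contacts (heights J) * S1 y
     + y * x * w * y ^+ contacts (heights J) * S2 + x * y ^+ contacts (heights J) * S3
     + x * y * (weight x y (heights J) - y ^+ contacts (heights J)) * S1 x)); last by ring.
  rewrite -!mulrA; congr (_ * (_ * _)); rewrite /S1 /S2 /S3 !mulr_sumr -!big_split.
  apply: eq_bigr => s _; rewrite heights_glue !weight_cat weight_head contacts_head expr1 [RHS]/=.
  have -> : weight x y (heights s.2) = weight x y (inner_heights 0 s.2) * y + x ^+ contacts (inner_heights 0 s.2) * y.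
    by rewrite /heights -cats1 weight_cat /= /contacts /= expr0 mulr0 addr0 mul1r expr1.
  by rewrite [contacts (_ ++ _)]count_cat exprD; ring.
have e1 : (y - 1) * S1 y = y ^+ contacts (heights T) - 1 by rewrite sum_splits_contacts.
have e2 := sum_splits_weight_left y T; rewrite -/S2 in e2.
have e3 := sum_splits_weight_right x y T; rewrite -/S3 -/(S1 y) in e3.
rewrite -e2 -e1.
have -> : x ^+ 2 * (y - 1) * (weight x y (heights T) - weight 1 y (heights T)) =
   x * (y - 1) * ((x - 1) * S3 - (x - 1) * (y * S1 y)) by rewrite e3; ring.
have ex : (x - 1) * S1 x = x ^+ contacts (heights T) - 1 by rewrite sum_splits_contacts.
by rewrite -ex; ring.
Qed.

(** Coefficient of $t^n$ in $F(x)$, as [Gsum] is for $G(x,y)$. The variables are arbitrary ring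
    elements, so that series can be substituted for them later. *)
Definition Fsum x n := \sum_(K <- intervals n) x ^+ contacts (heights K.1).
Definition Gsum x y n := \sum_(K <- intervals n) weight x y (heights K.1).

Lemma Fsum0 x : Fsum x 0 = x.
Proof. by rewrite /Fsum /intervals big_seq1 /= /contacts /= expr1. Qed.

Lemma Gsum0 x y : Gsum x y 0 = y.
Proof. by rewrite /Gsum /intervals big_seq1 weight_leaf. Qed.

Lemma FsumS x n : (x - 1) * Fsum x n.+1 =
  \sum_(k < n.+1) x * (Fsum x k - Fsum 1 k) * Fsum x (n - k).
Proof.
rewrite /Fsum (sum_intervalsS n (fun T => x ^+ contacts (heights T))) mulr_sumr.
apply: eq_bigr => k _; rewrite -sumrB [x * _]mulr_sumr big_distrlr mulr_sumr.
apply: eq_bigr => K _; rewrite mulr_sumr; apply: eq_bigr => J _; rewrite [RHS]/=.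
rewrite expr1n -sum_splits_contacts [RHS](_ : _ = (x - 1) * ((\sum_(s <- splits K.1)
  x ^+ contacts (inner_heights 0 s.2)) * (x * x ^+ contacts (heights J.1)))); last by ring.
congr (_ * _).
rewrite mulr_suml; apply: eq_bigr => s _.
rewrite heights_glue /contacts !count_cat -!/(contacts _) contacts_head !exprD; ring.
Qed.

Lemma GsumS x y n : (x - 1) * (y - 1) * y * Gsum x y n.+1 =
  \sum_(k < n.+1)
    (((x - 1) * y * (y + x) * (Fsum y k - Fsum 1 k)
      + y * x * w * (x - 1) * (Gsum 1 y k - Gsum 1 1 k)
      + x ^+ 2 * (y - 1) * (Gsum x y k - Gsum 1 y k)
      - x * y * (y - 1) * (Fsum x k - Fsum 1 k)) * Fsum y (n - k)
     + x * y * (y - 1) * (Fsum x k - Fsum 1 k) * Gsum x y (n - k)).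
Proof.
rewrite /Gsum (sum_intervalsS n (fun T => weight x y (heights T))) mulr_sumr.
apply: eq_bigr => k _; rewrite /Fsum -!sumrB.
rewrite ![_ * (\sum_(i <- intervals k) _)]mulr_sumr -!big_split -sumrB !big_distrlr -big_split.
apply: eq_bigr => K _; rewrite mulr_sumr -big_split.
by apply: eq_bigr => J _; rewrite sum_splits_weight !expr1n.
Qed.

(** Link with the definition of $G$: contacts in a prefix and in the remaining suffix of [heights]
    are [contact_lt] and [contact_ge]. *)
Lemma Gsum_intervals x y n :
  \sum_(P : (2 * n).-tuple bool) \sum_(Q : (2 * n).-tuple bool | is_interval P Q)
    \sum_(i < (2 * n).+1) w ^+ `|height P i|%N * x ^+ contact_lt P i * y ^+ contact_ge P i
  = Gsum x y n.
Proof.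
pose phi (s : seq bool) :=
  \sum_(i < (2 * n).+1) w ^+ `|height s i|%N * x ^+ contact_lt s i * y ^+ contact_ge s i.
rewrite (sum_is_interval n phi) /Gsum !big_seq; apply: eq_bigr => -[P Q] /mem_intervals[sP _] /=.
have sz : (2 * n)%N = size (word P) by rewrite size_word sP.
rewrite weight_sum -heights_word size_path_heights -sz; apply: eq_bigr => i _.
have lei : (i <= size (word P))%N by rewrite -sz -ltnS ltn_ord.
have cE s : contacts [seq `|height (word P) j|%N | j <- s] = count (fun j => height (word P) j == 0) s.
  by rewrite /contacts count_map; apply: eq_count => j /=; rewrite absz_eq0.
rewrite path_heights_word (nth_map 0%N) ?size_iota ?ltnS // nth_iota // add0n.
rewrite -map_take -map_drop !cE take_iota drop_iota add0n.
by rewrite /contact_lt /contact_ge (minn_idPl (leqW lei)).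
Qed.

End Sums.

Lemma rmorph_Fsum (A B : comNzRingType) (f : {rmorphism A -> B}) x n :
  f (Fsum x n) = Fsum (f x) n.
Proof. by rewrite rmorph_sum; apply: eq_bigr => K _; rewrite rmorphXn. Qed.

Lemma rmorph_Gsum (A B : comNzRingType) (f : {rmorphism A -> B}) w x y n :
  f (Gsum w x y n) = Gsum (f w) (f x) (f y) n.
Proof.
rewrite rmorph_sum; apply: eq_bigr => K _; rewrite !weight_sum rmorph_sum.
by apply: eq_bigr => i _; rewrite !rmorphM !rmorphXn.
Qed.

(** * Formal power series *)

(** A separate name for [ser], on which the ring structures are declared. *)
Definition fps (R : Type) := ser R.

HB.instance Definition _ (R : Type) := gen_eqMixin (fps R).
HB.instance Definition _ (R : Type) := gen_choiceMixin (fps R).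

Section FpsRing.
Variable R : comNzRingType.
Implicit Types f g h : fps R.

Lemma fpsP f g : (forall n, f n = g n) -> f = g.
Proof. exact: funext. Qed.

Fact fps_addA : associative (@sadd R : fps R -> fps R -> fps R).
Proof. by move=> f g h; apply: fpsP => n; rewrite /sadd addrA. Qed.
Fact fps_addC : commutative (@sadd R : fps R -> fps R -> fps R).
Proof. by move=> f g; apply: fpsP => n; rewrite /sadd addrC. Qed.
Fact fps_add0 : left_id (@szero R : fps R) (@sadd R).
Proof. by move=> f; apply: fpsP => n; rewrite /sadd add0r. Qed.
Fact fps_addN : left_inverse (@szero R : fps R) (@sneg R) (@sadd R).
Proof. by move=> f; apply: fpsP => n; rewrite /sadd addNr. Qed.

HB.instance Definition _ :=
  GRing.isZmodule.Build (fps R) fps_addA fps_addC fps_add0 fps_addN.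

(** Truncation to a polynomial; commutativity and associativity of the product are inherited from
    [{poly R}] through it. *)
Definition fpsX n (f : fps R) : {poly R} := \poly_(i < n) f i.

Lemma coef_smul f g n : (smul f g) n = (fpsX n.+1 f * fpsX n.+1 g)`_n.
Proof.
rewrite coefM; apply: eq_bigr => i _.
by rewrite !coef_poly ltn_ord ltnS leq_subr.
Qed.

Lemma smulE f g m n : (n < m)%N -> (smul f g) n = (fpsX m f * fpsX m g)`_n.
Proof.
move=> lt_nm; rewrite coefM; apply: eq_bigr => i _; rewrite !coef_poly.
by rewrite (leq_ltn_trans (leq_ord i) lt_nm) (leq_ltn_trans (leq_subr i n) lt_nm).
Qed.

Fact fps_mulC : commutative (@smul R : fps R -> fps R -> fps R).
Proof. by move=> f g; apply: fpsP => n; rewrite !coef_smul mulrC. Qed.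

Fact fps_mulA : associative (@smul R : fps R -> fps R -> fps R).
Proof.
move=> f g h; apply: fpsP => n.
have E (f1 g1 : fps R) (i : 'I_n.+1) :
  (smul f1 g1) i = (fpsX n.+1 f1 * fpsX n.+1 g1)`_i by apply: smulE.
transitivity ((fpsX n.+1 f * (fpsX n.+1 g * fpsX n.+1 h))`_n).
  rewrite coefM; apply: eq_bigr => i _; rewrite coef_poly ltn_ord.
  by rewrite (@smulE _ _ n.+1) // ltnS leq_subr.
rewrite mulrA coefM; apply: eq_bigr => i _; rewrite coef_poly ltnS leq_subr.
by rewrite E.
Qed.

Fact fps_mul1 : left_id (@sone R : fps R) (@smul R).
Proof.
move=> f; apply: fpsP => n; rewrite /smul big_ord_recl big1 => [|i _].
  by rewrite /sone /sconst /= subn0 mul1r addr0.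
by rewrite /sone /sconst /= mul0r.
Qed.

Fact fps_mulDl : left_distributive (@smul R : fps R -> fps R -> fps R) (@sadd R).
Proof.
move=> f g h; apply: fpsP => n; rewrite /smul /sadd -big_split.
by apply: eq_bigr => i _; rewrite mulrDl.
Qed.

Fact fps_1_neq0 : (@sone R : fps R) != 0.
Proof. by apply/eqP => /(congr1 (fun f : fps R => f 0%N)) /eqP; rewrite oner_eq0. Qed.

HB.instance Definition _ := GRing.Zmodule_isComNzRing.Build (fps R)
  fps_mulA fps_mulC fps_mul1 fps_mulDl fps_1_neq0.

Lemma fpsD f g n : (f + g) n = f n + g n. Proof. by []. Qed.
Lemma fpsN f n : (- f) n = - f n. Proof. by []. Qed.
Lemma fpsB f g n : (f - g) n = f n - g n. Proof. by []. Qed.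
Lemma fpsM f g n : (f * g) n = \sum_(i < n.+1) f i * g (n - i)%N. Proof. by []. Qed.
Lemma fps0 n : (0 : fps R) n = 0. Proof. by []. Qed.
Lemma fps1 n : (1 : fps R) n = (n == 0%N)%:R. Proof. by case: n. Qed.

Lemma fps_sum (I : Type) (r : seq I) (P : pred I) (F : I -> fps R) n :
  (\sum_(i <- r | P i) F i) n = \sum_(i <- r | P i) F i n.
Proof. by elim/big_rec2: _ => // i y1 y2 _ <-. Qed.

Lemma spowE f k : spow f k = f ^+ k :> fps R.
Proof. by rewrite /spow; elim: k => //= k ->; rewrite exprS. Qed.

Lemma fpsM0 f g : (f * g) 0%N = f 0%N * g 0%N.
Proof. by rewrite fpsM big_ord1. Qed.

Lemma fpsX0 f k : (f ^+ k) 0%N = f 0%N ^+ k.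
Proof. by elim: k => // k IH; rewrite !exprS fpsM0 IH. Qed.

Definition fpsC (c : R) : fps R := sconst c.
Definition fpst : fps R := @tser R.

Lemma fpsCM c f n : (fpsC c * f) n = c * f n.
Proof.
rewrite fpsM big_ord_recl big1 => [|i _]; first by rewrite /= subn0 addr0.
by rewrite /fpsC /sconst /= mul0r.
Qed.

Fact fpsC_is_zmod_morphism : zmod_morphism fpsC.
Proof. by move=> a b; apply: fpsP => -[|n] //; rewrite fpsB /fpsC /sconst /= subrr. Qed.
Fact fpsC_is_monoid_morphism : monoid_morphism fpsC.
Proof.
split=> // a b; apply: fpsP => n; rewrite fpsCM /fpsC /sconst.
by case: eqP => // _; rewrite mulr0.
Qed.
HB.instance Definition _ := GRing.isZmodMorphism.Build R (fps R) fpsC fpsC_is_zmod_morphism.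
HB.instance Definition _ := GRing.isMonoidMorphism.Build R (fps R) fpsC fpsC_is_monoid_morphism.

Lemma fpstM f n : (fpst * f) n = if n is n'.+1 then f n' else 0.
Proof.
case: n => [|n]; first by rewrite fpsM0 mul0r.
rewrite fpsM big_ord_recl mul0r add0r big_ord_recl mul1r big1 => [|i _].
  by rewrite /= addr0 subSS subn0.
by rewrite /fpst /tser /= mul0r.
Qed.

Lemma fpstXM k f n : (fpst ^+ k * f) n = if (n < k)%N then 0 else f (n - k)%N.
Proof.
elim: k n => [|k IH] n; first by rewrite mul1r subn0.
by rewrite exprS -mulrA fpstM; case: n => [|n] //; rewrite IH ltnS.
Qed.

(** * Congruence modulo $t^n$ and fixpoints of contractions *)

Definition eqmodt n f g := forall i, (i < n)%N -> f i = g i.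

Lemma eqmodt_refl n f : eqmodt n f f. Proof. by []. Qed.
Lemma eqmodtD n f g f' g' : eqmodt n f f' -> eqmodt n g g' -> eqmodt n (f + g) (f' + g').
Proof. by move=> ef eg i lti; rewrite !fpsD ef ?eg. Qed.
Lemma eqmodtN n f f' : eqmodt n f f' -> eqmodt n (- f) (- f').
Proof. by move=> ef i lti; rewrite !fpsN ef. Qed.
Lemma eqmodtM n f g f' g' : eqmodt n f f' -> eqmodt n g g' -> eqmodt n (f * g) (f' * g').
Proof.
move=> ef eg i lti; rewrite !fpsM; apply: eq_bigr => j _.
by rewrite (ef _ (leq_ltn_trans (leq_ord j) lti)) (eg _ (leq_ltn_trans (leq_subr j i) lti)).
Qed.
Lemma eqmodtX n f f' k : eqmodt n f f' -> eqmodt n (f ^+ k) (f' ^+ k).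
Proof. by move=> ef; elim: k => // k IH; rewrite !exprS; apply: eqmodtM. Qed.
Lemma eqmodt_mull n (c f f' : fps R) : c 0%N = 0 -> eqmodt n f f' -> eqmodt n.+1 (c * f) (c * f').
Proof.
move=> c0 ef i lti; rewrite !fpsM; apply: eq_bigr => -[[|j] ltj] _ /=.
  by rewrite c0 !mul0r.
rewrite ef //; case: i lti ltj => [|i] //= lti ltj.
by rewrite subSS (leq_ltn_trans (leq_subr _ _)).
Qed.

Definition contractive (Phi : fps R -> fps R) :=
  forall n f g, eqmodt n f g -> eqmodt n.+1 (Phi f) (Phi g).

(** The iterates from 0 agree below order $n$ from the $n$-th one on, so their diagonal is a limit,
    and it is fixed. *)
Lemma contractive_fix Phi : contractive Phi -> {f : fps R | Phi f = f}.
Proof.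
move=> cPhi; pose it n := iter n Phi 0.
have it_stab n m : (n <= m)%N -> eqmodt n (it n) (it m).
  elim: n m => [|n IH] [|m] // le_nm; exact/cPhi/IH.
exists (fun n => it n.+1 n); apply: fpsP => n.
have e : eqmodt n (fun n => it n.+1 n) (it n).
  by move=> i lti; rewrite (@it_stab i.+1 n).
by rewrite (cPhi _ _ _ e n (ltnSn n)).
Qed.

Lemma contractive_uniq Phi f g : contractive Phi -> Phi f = f -> Phi g = g -> f = g.
Proof.
move=> cPhi ef eg; have e n : eqmodt n f g.
  by elim: n => // n IH; rewrite -ef -eg; apply: cPhi.
by apply: fpsP => n; apply: (e n.+1).
Qed.

(** The inverse is the fixpoint of $g\mapsto 1+(1-f)g$, a contraction because $1-f$ has no constant
    term. *)
Lemma fps_inv f : f 0%N = 1 -> {g : fps R | f * g = 1}.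
Proof.
move=> f0; case: (@contractive_fix (fun g => 1 + (1 - f) * g)) => [n g h e|g e].
  by apply: eqmodtD => //; apply: eqmodt_mull; rewrite // fpsB f0 subrr.
exists g; have -> : f * g = 1 - ((1 + (1 - f) * g) - g) by ring.
by rewrite e subrr subr0.
Qed.

Lemma fps_regular f g h : f 0%N = 1 -> f * g = f * h -> g = h.
Proof.
move=> /fps_inv[k fk] /(congr1 (fun p => k * p)).
by rewrite !mulrA ![k * f]mulrC fk !mul1r.
Qed.

End FpsRing.

Arguments fpst {R}.

Section FpsUnit.
Variable R : comNzRingType.

(** Invertibility is decided classically. The unit ring structure is a step towards the integral
    domain of series and its field of fractions. *)
Definition fps_unit : {pred fps R} := fun f => `[< exists g, g * f = 1 >].
Definition fps_invr (f : fps R) : fps R :=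
  if pselect (exists g, g * f = 1) is left ex then projT1 (cid ex) else f.

Fact fps_mulVr : {in fps_unit, left_inverse 1 fps_invr *%R}.
Proof.
move=> f /asboolP uf; rewrite /fps_invr; case: pselect => // ex.
by case: (cid ex).
Qed.
Fact fps_unitP (f g : fps R) : g * f = 1 -> f \in fps_unit.
Proof. by move=> gf; apply/asboolP; exists g. Qed.
Fact fps_invr_out : {in [predC fps_unit], fps_invr =1 id}.
Proof. by move=> f /asboolP nuf; rewrite /fps_invr; case: pselect. Qed.

HB.instance Definition _ := GRing.ComNzRing_hasMulInverse.Build (fps R)
  fps_mulVr fps_unitP fps_invr_out.

End FpsUnit.

Section FpsDomain.
Variable R : idomainType.

(** The product of the lowest nonzero coefficients of two series is a coefficient of their
    product. *)
Fact fps_mul_eq0 : GRing.integral_domain_axiom (fps R).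
Proof.
move=> f g fg0; apply/orP; case: (pselect (f = 0)) => [->|nf]; [by left|right].
case: (pselect (g = 0)) => [-> //|ng]; exfalso.
have low (h : fps R) : h <> 0 -> exists n, h n != 0 /\ forall i, (i < n)%N -> h i = 0.
  move=> nh; have [n hn] : exists n, h n != 0.
    apply: contrapT => H; apply: nh; apply: fpsP => n.
    by apply/eqP; apply: contrapT => hn; apply: H; exists n; apply/negP.
  case: (ex_minnP (ex_intro (fun n => h n != 0) n hn)) => m hm min.
  exists m; split=> // i; rewrite ltnNge => lti; apply/eqP/negPn/negP => hi.
  by rewrite min in lti.
have [a [fa lfa]] := low _ nf; have [b [gb lgb]] := low _ ng.
have /eqP := congr1 (fun h : fps R => h (a + b)%N) fg0.
rewrite fps0 fpsM (bigD1 (Ordinal (leq_addr b a : (a < (a + b).+1)%N))) //= addKn.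
rewrite big1 => [|i nia].
  by rewrite addr0 mulf_eq0 (negPf fa) (negPf gb).
have [ltia|ltai|eqia] := ltngtP i a.
- by rewrite lfa // mul0r.
- by rewrite (lgb (a + b - i)%N) ?mulr0 // ltn_subLR ?ltn_add2r // -ltnS.
- by case/eqP: nia; apply: val_inj.
Qed.

HB.instance Definition _ := GRing.ComUnitRing_isIntegral.Build (fps R) fps_mul_eq0.

End FpsDomain.

(* Sends [\sum_n f_n t^n] to [\sum_n phi f_n t^n], the latter sum in [fps R];
   it substitutes a series for a variable of the coefficients. *)
Definition lift_fps (A : Type) (R : comNzRingType) (phi : A -> fps R) (f : fps A) : fps R :=
  fun m => \sum_(n < m.+1) phi (f n) (m - n)%N.

Lemma lift_eqmodt (A : Type) (R : comNzRingType) (phi : A -> fps R) (f : fps A) m :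
  eqmodt m.+1 (lift_fps phi f) (\sum_(n < m.+1) fpst ^+ n * phi (f n)).
Proof.
move=> i lti; rewrite fps_sum /lift_fps.
rewrite (big_ord_widen m.+1 (fun n => phi (f n) (i - n)%N) lti) big_mkcond.
by apply: eq_bigr => n _; rewrite fpstXM ltnS; case: leqP.
Qed.

(** * Substitution as a ring morphism *)

Section Lift.
Variables (A R : comNzRingType) (phi : {rmorphism A -> fps R}).

Fact lift_is_zmod_morphism : zmod_morphism (lift_fps phi : fps A -> fps R).
Proof.
move=> f g; apply: fpsP => m; rewrite fpsB /lift_fps -sumrB.
by apply: eq_bigr => i _; rewrite fpsB rmorphB fpsB.
Qed.

Fact lift_is_monoid_morphism : monoid_morphism (lift_fps phi : fps A -> fps R).
Proof.
split.
  apply: fpsP => m; rewrite /lift_fps big_ord_recl big1 => [|i _].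
    by rewrite /= rmorph1 addr0 subn0.
  by rewrite /= (rmorph0 phi) fps0.
move=> f g; apply: fpsP => m.
rewrite (@lift_eqmodt _ _ _ _ m) // (eqmodtM (@lift_eqmodt _ _ _ f m) (@lift_eqmodt _ _ _ g m)) //.
pose P (h : fps A) := \poly_(i < m.+1) phi (h i).
have PE (h : fps A) : \sum_(n < m.+1) fpst ^+ n * phi (h n) = (P h).[fpst].
  by rewrite horner_poly; apply: eq_bigr => n _; rewrite mulrC.
rewrite !PE -hornerM.
(* The product of the truncations is the truncated product up to a multiple of ['X^(m.+1)], which
   after evaluation at $t$ does not reach the coefficient [m]. *)
have -> : P f * P g = P (f * g) + 'X^(m.+1) * \poly_(i < m.+1) (P f * P g)`_(i + m.+1).
  apply/polyP => i; rewrite coefD coefXnM !coef_poly.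
  case: ltnP => [lti|lei].
    rewrite addr0 coefM fpsM rmorph_sum; apply: eq_bigr => j _.
    rewrite !coef_poly rmorphM (leq_ltn_trans (leq_ord j) lti).
    by rewrite (leq_ltn_trans (leq_subr j i) lti).
  rewrite add0r subnK //; case: ltnP => // le2.
  rewrite nth_default //; apply: leq_trans (size_polyMleq _ _) _.
  have sP (h : fps A) : (size (P h) <= m.+1)%N by apply: size_poly.
  have := leq_add (sP f) (sP g); rewrite -subn1 leq_subLR => /leq_trans; apply.
  by rewrite -(leq_add2r m.+1) subnK // in le2; apply: leq_trans le2 (leqW _).
rewrite hornerD hornerM hornerXn fpsD [X in _ + X](_ : _ = 0) ?addr0 //.
by rewrite fpstXM ltnSn.
Qed.

HB.instance Definition _ :=
  GRing.isZmodMorphism.Build (fps A) (fps R) (lift_fps phi) lift_is_zmod_morphism.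
HB.instance Definition _ :=
  GRing.isMonoidMorphism.Build (fps A) (fps R) (lift_fps phi) lift_is_monoid_morphism.

Lemma lift_t : lift_fps phi fpst = fpst.
Proof.
apply: fpsP => -[|m]; rewrite /lift_fps.
  by rewrite big_ord1 /fpst /tser /= rmorph0.
rewrite 2!big_ord_recl big1 => [|i _]; last by rewrite /fpst /tser /= rmorph0.
rewrite /fpst /tser /= rmorph0 rmorph1 fps0 add0r addr0 fps1 subSS subn0.
by case: m.
Qed.

Lemma lift_C a : lift_fps phi (fpsC a) = phi a.
Proof.
apply: fpsP => m; rewrite /lift_fps big_ord_recl big1 => [|i _].
  by rewrite /= addr0 subn0.
by rewrite /fpsC /sconst /= rmorph0.
Qed.

Lemma lift_0 f : (lift_fps phi f) 0%N = phi (f 0%N) 0%N.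
Proof. by rewrite /lift_fps big_ord1. Qed.

End Lift.

(** * Functional equations *)

Section SeriesEq.
Variable B : comNzRingType.
Implicit Types (x y w c : B) (f : fps B).

Definition Fser x : fps B := Fsum x.
Definition Gxyser w x y : fps B := Gsum w x y.

Lemma fpsCB_coef x f n : ((fpsC x - 1) * f) n = (x - 1) * f n.
Proof. by rewrite -(rmorph1 (@fpsC B)) -rmorphB fpsCM. Qed.

Lemma fps_eqS f g c : f 0%N = c -> (forall n, f n.+1 = g n) -> f = fpsC c + fpst * g.
Proof.
by move=> f0 fS; apply: fpsP => -[|n]; rewrite fpsD fpstM ?addr0 // fS [fpsC _ _]/= add0r.
Qed.

Lemma Fser_eq x : (fpsC x - 1) * Fser x =
  fpsC x * (fpsC x - 1) + fpst * (fpsC x * ((Fser x - Fser 1) * Fser x)).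
Proof.
have -> : fpsC x - 1 = fpsC (x - 1) by rewrite rmorphB rmorph1.
rewrite -rmorphM; apply: fps_eqS => [|n]; rewrite !fpsCM.
  by rewrite /Fser Fsum0 mulrC.
rewrite /Fser FsumS fpsM mulr_sumr; apply: eq_bigr => k _.
by rewrite fpsB mulrA.
Qed.

Lemma Gxyser_eq w x y :
  let X := fpsC x in let Y := fpsC y in let W := fpsC w in
  (X - 1) * (Y - 1) * Y * Gxyser w x y = (X - 1) * (Y - 1) * Y * Y +
    fpst * (((X - 1) * Y * (Y + X) * (Fser y - Fser 1)
      + Y * X * W * (X - 1) * (Gxyser w 1 y - Gxyser w 1 1)
      + X ^+ 2 * (Y - 1) * (Gxyser w x y - Gxyser w 1 y)
      - X * Y * (Y - 1) * (Fser x - Fser 1)) * Fser y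
     + X * Y * (Y - 1) * (Fser x - Fser 1) * Gxyser w x y).
Proof.
move=> X Y W.
have eX : X - 1 = fpsC (x - 1) by rewrite rmorphB rmorph1.
have eY : Y - 1 = fpsC (y - 1) by rewrite rmorphB rmorph1.
rewrite eX eY /X /Y /W -!rmorphM; apply: fps_eqS => [|n]; rewrite !fpsCM.
  by rewrite /Gxyser Gsum0.
rewrite /Gxyser GsumS -rmorphXn -!rmorphD -!rmorphM fpsD !fpsM -big_split; apply: eq_bigr => k _.
by rewrite fpsB !fpsD !fpsCM !fpsB.
Qed.

End SeriesEq.

Section SpecialisedSeries.
Variable A : comNzRingType.
Implicit Types (X Y W z u : fps A).

(* [\sum_n t^n F_n(X)], where the argument is itself a series. *)
Definition Feval X : fps A := lift_fps idfun (Fser X).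
Definition Geval W X Y : fps A := lift_fps idfun (Gxyser W X Y).

Lemma lift_map (f : nat -> A) (g : fps (fps A)) : (forall n, g n = fpsC (f n)) -> lift_fps idfun g = f.
Proof.
move=> e; apply: fpsP => n; rewrite /lift_fps big_ord_recr /= big1 => [|k _].
  by rewrite add0r subnn e.
by rewrite e /fpsC /sconst subn_eq0 leqNgt ltn_ord.
Qed.

Lemma lift_idC X : lift_fps idfun (fpsC X) = X.
Proof. exact: (lift_C idfun X). Qed.

Lemma Geval_C w x y : Geval (fpsC w) (fpsC x) (fpsC y) = Gxyser w x y.
Proof. by apply: lift_map => n; rewrite /Gxyser rmorph_Gsum. Qed.

Lemma Feval_eq X : (X - 1) * Feval X = X * (X - 1) + fpst * X * (Feval X - Feval 1) * Feval X.
Proof.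
have := congr1 (lift_fps idfun) (Fser_eq X).
rewrite !(rmorphM, rmorphB, rmorphD, rmorph1) /= lift_t !lift_idC -/(Feval X) -/(Feval 1).
by move=> ->; rewrite !mulrA.
Qed.

Lemma Geval_eq W X Y :
  (X - 1) * (Y - 1) * Y * Geval W X Y = (X - 1) * (Y - 1) * Y * Y +
    fpst * (((X - 1) * Y * (Y + X) * (Feval Y - Feval 1)
      + Y * X * W * (X - 1) * (Geval W 1 Y - Geval W 1 1)
      + X ^+ 2 * (Y - 1) * (Geval W X Y - Geval W 1 Y)
      - X * Y * (Y - 1) * (Feval X - Feval 1)) * Feval Y
     + X * Y * (Y - 1) * (Feval X - Feval 1) * Geval W X Y).
Proof.
have := congr1 (lift_fps idfun) (Gxyser_eq W X Y).
by rewrite !(rmorphM, rmorphB, rmorphD, rmorph1, rmorphXn) /= lift_t !lift_idC.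
Qed.

(** * The parameters $z$ and $u$ *)

Definition is_z z := z 0%N = 0 /\ z * (1 - z) ^+ 3 = fpst.

Lemma is_z_uniq z z' : is_z z -> is_z z' -> z = z'.
Proof.
case=> z0 ez [z'0 ez'].
(* [r] is the cofactor of $z-z'$ in $z(1-z)^3-z'(1-z')^3$; its constant term is 1, so it can be
   cancelled. *)
pose r := 1 + z * (3%:R * (z + z' - 1) - z ^+ 2 - z' ^+ 2)
            + z' * (3%:R * (z' - 1) - z ^+ 2 - z' ^+ 2).
have r0 : r 0%N = 1 by rewrite /r !fpsD !fpsM0 z0 z'0 !mul0r !addr0 fps1.
apply/eqP; rewrite -subr_eq0; apply/eqP/(fps_regular r0); rewrite mulr0.
have -> : r * (z - z') = z * (1 - z) ^+ 3 - z' * (1 - z') ^+ 3 by rewrite /r; ring.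
by rewrite ez ez' subrr.
Qed.

(** With $z=ts$ the equation becomes $s(1-ts)^3=1$, that is $s=1+ts^2(3-3ts+t^2s^2)$, a contraction
    in $s$. *)
Lemma is_z_exists : exists z, is_z z.
Proof.
have [s es] : {s : fps A | 1 + fpst * (s ^+ 2 * (3%:R - 3%:R * fpst * s + fpst ^+ 2 * s ^+ 2)) = s}.
  apply: contractive_fix => n f g e; apply: eqmodtD => //; apply: eqmodt_mull => //.
  by do !(apply: eqmodtD || apply: eqmodtM || apply: eqmodtX || apply: eqmodtN || exact: e || exact: eqmodt_refl).
exists (fpst * s); split; first by rewrite fpsM0 mul0r.
rewrite -[RHS]mulr1 -mulrA; congr (_ * _).
have -> : s * (1 - fpst * s) ^+ 3 = 1 - ((1 + fpst * (s ^+ 2 * (3%:R - 3%:R * fpst * s + fpst ^+ 2 * s ^+ 2))) - s) by ring.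
by rewrite es subrr subr0.
Qed.

(* [X = (1 + u) / (1 + z u)^2] *)
Definition is_u z X u := X * (1 + z * u) ^+ 2 = 1 + u.

Lemma contractive_u z X : z 0%N = 0 -> contractive (fun u => X - 1 + z * (X * u * (2%:R + z * u))).
Proof.
move=> z0 n f g e; apply: eqmodtD => //; apply: eqmodt_mull => //.
by do !(apply: eqmodtD || apply: eqmodtM || exact: e || exact: eqmodt_refl).
Qed.

Lemma is_u_uniq z X u u' : z 0%N = 0 -> is_u z X u -> is_u z X u' -> u = u'.
Proof.
move=> z0 eu eu'; apply: (contractive_uniq (contractive_u X z0)).
  by rewrite -[RHS](addKr 1 u) -eu; ring.
by rewrite -[RHS](addKr 1 u') -eu'; ring.
Qed.

Lemma is_u_exists z X : z 0%N = 0 -> exists u, is_u z X u.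
Proof.
move=> z0; have [u eu] := contractive_fix (contractive_u X z0).
by exists u; rewrite /is_u -[in RHS]eu; ring.
Qed.

End SpecialisedSeries.

Lemma lift_is_z (A B : comNzRingType) (phi : {rmorphism A -> fps B}) z :
  is_z z -> is_z (lift_fps phi z).
Proof.
case=> z0 ez; split; first by rewrite lift_0 z0 rmorph0.
by rewrite -(lift_t phi) -ez !(rmorphM, rmorphB, rmorphXn, rmorph1).
Qed.

Lemma lift_is_u (A B : comNzRingType) (phi : {rmorphism A -> fps B}) z X u :
  is_u z X u -> is_u (lift_fps phi z) (lift_fps phi X) (lift_fps phi u).
Proof.
by rewrite /is_u -(rmorph1 (lift_fps phi)) -!rmorphM -!rmorphD -rmorphXn -rmorphM => ->.
Qed.

Lemma rmorph_param (R S : comNzRingType) (f : {rmorphism R -> S}) (F z u : R) :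
  F * ((1 + z * u) * (1 - z) ^+ 3) = (1 + u) * (1 - 2%:R * z - z ^+ 2 * u) ->
  f F * ((1 + f z * f u) * (1 - f z) ^+ 3) = (1 + f u) * (1 - 2%:R * f z - f z ^+ 2 * f u).
Proof.
by move=> /(congr1 f); rewrite !(rmorphM, rmorphD, rmorphN, rmorphXn, rmorph1, rmorph_nat).
Qed.

(* The generic series has polynomial coefficients, and is determined by its
   functional equation because [x - 1] is regular in [{poly int}]. *)
Section GenericF.
Let A : idomainType := {poly int}.
Let x : A := 'X.
Let eval1 : {rmorphism A -> fps A} := @fpsC A \o polyC \o horner_eval 1.

Lemma Fser_unique (Phi : fps A) :
  (fpsC x - 1) * Phi =
    fpsC x * (fpsC x - 1) + fpst * (fpsC x * ((Phi - lift_fps eval1 Phi) * Phi)) ->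
  Phi = Fser x.
Proof.
move=> e; have xn0 : x - 1 != 0 by rewrite polyXsubC_eq0.
have ev k : (lift_fps eval1 Phi) k = ((Phi k).[1])%:P.
  rewrite /lift_fps big_ord_recr /= big1 => [|i _]; first by rewrite add0r subnn.
  by rewrite /= /fpsC /sconst subn_eq0 leqNgt ltn_ord.
have F1 k : Fser 1 k = ((Fser x k).[1])%:P.
  have := rmorph_Fsum (@polyC int \o horner_eval 1) x k.
  by rewrite /= /horner_eval hornerX.
(* The coefficient $n+1$ of the right-hand side involves only coefficients of index at most $n$,
   which makes the induction work. *)
have coefE (f g : fps A) n :
    (fpsC x * (fpsC x - 1) + fpst * (fpsC x * ((f - g) * f))) n.+1
    = x * \sum_(k < n.+1) (f k - g k) * f (n - k)%N.
  rewrite fpsD fpstM !fpsCM fpsB fpsM /fpsC /sconst fps1 /= subrr mulr0 add0r; congr (_ * _).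
have eF := Fser_eq x.
suff H n : forall k, (k <= n)%N -> Phi k = Fser x k by apply: fpsP => n; apply: (H n).
elim: n => [|n IH] k.
  rewrite leqn0 => /eqP ->; apply: (mulfI xn0); rewrite -(fpsCB_coef x Phi) -(fpsCB_coef x (Fser x)) e eF.
  by rewrite !fpsD !fpstM.
rewrite leq_eqVlt => /predU1P[->|]; last exact: IH.
apply: (mulfI xn0); rewrite -(fpsCB_coef x Phi) -(fpsCB_coef x (Fser x)) e eF !coefE; congr (_ * _).
apply: eq_bigr => k' _; rewrite ev F1 !IH ?leq_subr //; exact: leq_ord.
Qed.

(** The rational expression [Phi] is shown to satisfy the functional equation, and [Fser_unique]
    identifies it with $F(x)$. *)
Lemma Fser_param z u : is_z z -> is_u z (fpsC x) u ->
  Fser x * ((1 + z * u) * (1 - z) ^+ 3) = (1 + u) * (1 - 2%:R * z - z ^+ 2 * u).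
Proof.
move=> zz uu; have [z0 ez] := zz.
have s0 : (1 + z * u) 0%N = 1 by rewrite fpsD fpsM0 z0 mul0r addr0 fps1.
have r0 : (1 - z) 0%N = 1 by rewrite fpsB z0 subr0 fps1.
pose d := (1 + z * u) * (1 - z) ^+ 3.
have d0 : d 0%N = 1 by rewrite /d fpsM0 s0 fpsX0 r0 expr1n mul1r.
have [k dk] := fps_inv d0.
pose Phi := (1 + u) * (1 - 2%:R * z - z ^+ 2 * u) * k.
have ePhi : Phi * d = (1 + u) * (1 - 2%:R * z - z ^+ 2 * u).
  by rewrite /Phi -mulrA [k * d]mulrC dk mulr1.
rewrite -/d -ePhi; congr (_ * _); symmetry; apply: Fser_unique.
pose Phi1 := lift_fps eval1 Phi; rewrite -/Phi1.
have zz1 : lift_fps eval1 z = z by apply: is_z_uniq => //; apply: lift_is_z.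
(* At $x=1$ the parameter becomes 0, so [Phi] specialises to $(1-2z)/(1-z)^3$. *)
have u1 : lift_fps eval1 u = 0.
  have := lift_is_u eval1 uu; rewrite zz1 lift_C /= /horner_eval hornerX !rmorph1 => uu1.
  by apply: (is_u_uniq z0 uu1); rewrite /is_u; ring.
have ePhi1 : Phi1 * (1 - z) ^+ 3 = 1 - 2%:R * z.
  have : Phi1 * ((1 + lift_fps eval1 z * lift_fps eval1 u) * (1 - lift_fps eval1 z) ^+ 3) = (1 + lift_fps eval1 u) *
      (1 - 2%:R * lift_fps eval1 z - lift_fps eval1 z ^+ 2 * lift_fps eval1 u) := rmorph_param (lift_fps eval1) ePhi.
  by rewrite zz1 u1 !(mulr0, addr0, subr0, mul1r).
set X := fpsC x in uu *.
(* This regular factor clears all denominators: [X], [Phi] and [Phi1] can then be grouped into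
   $X(1+zu)^2$, [Phi * d] and $\Phi_1(1-z)^3$, whose values are known. *)
apply: (@fps_regular _ ((1 + z * u) ^+ 4 * d ^+ 2)).
  by rewrite fpsM0 !fpsX0 s0 d0 !expr1n mulr1.
transitivity ((X * (1 + z * u) ^+ 2 - (1 + z * u) ^+ 2) * (Phi * d) * ((1 + z * u) ^+ 2 * d)).
  by ring.
transitivity ((X * (1 + z * u) ^+ 2) * (X * (1 + z * u) ^+ 2 - (1 + z * u) ^+ 2) * d ^+ 2
  + fpst * (X * (1 + z * u) ^+ 2) * (1 + z * u) ^+ 2 *
    ((Phi * d) ^+ 2 - Phi1 * (1 - z) ^+ 3 * (Phi * d) * (1 + z * u))); last first.
  by rewrite /d; ring.
by rewrite uu ePhi ePhi1 -ez /d; ring.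
Qed.

End GenericF.

(** Any series [X] over any ring is the image under [ev] of the generic variable over the integers;
    by uniqueness [z] and [u] are the images of their generic counterparts. *)
Lemma Feval_param (A : comNzRingType) (X z u : fps A) : is_z z -> is_u z X u ->
  Feval X * ((1 + z * u) * (1 - z) ^+ 3) = (1 + u) * (1 - 2%:R * z - z ^+ 2 * u).
Proof.
move=> zz uu.
have [z' zz'] := is_z_exists {poly int}.
have [u' uu'] := is_u_exists (fpsC 'X) (proj1 zz').
pose ev : {rmorphism {poly int} -> fps A} := horner_eval X \o map_poly intr.
have evX : ev 'X = X by rewrite /= /horner_eval map_polyX hornerX.
have ez : lift_fps ev z' = z by apply: is_z_uniq => //; apply: lift_is_z.
have eu : lift_fps ev u' = u.
  have := lift_is_u ev uu'; rewrite lift_C -[X in is_u _ X]/(ev 'X) evX => h.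
  by apply: (is_u_uniq (proj1 zz) _ uu); rewrite -[in is_u z]ez.
have : lift_fps ev (Fser 'X) * ((1 + lift_fps ev z' * lift_fps ev u') * (1 - lift_fps ev z') ^+ 3) =
    (1 + lift_fps ev u') * (1 - 2%:R * lift_fps ev z' - lift_fps ev z' ^+ 2 * lift_fps ev u').
  have h := Fser_param zz' uu'; exact: rmorph_param (lift_fps ev) _ _ _ h.
rewrite ez eu => <-; congr (_ * _).
have FE k : ev (Fsum 'X k) = Fsum X k by rewrite -[in RHS]evX; exact: rmorph_Fsum.
apply: fpsP => n; apply: eq_bigr => i _.
by rewrite -[idfun _]/(Fsum X i) -FE.
Qed.

(* The third equation on [X] cancels the coefficient of [G]. *)
Lemma kernel_first (R : idomainType) (t X Y W f g f1 G H K : R) :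
  X != 0 -> X - 1 != 0 ->
  (X - 1) * f = X * (X - 1) + t * X * (f - f1) * f ->
  (Y - 1) * g = Y * (Y - 1) + t * Y * (g - f1) * g ->
  (X - 1) * Y = t * X * f * g ->
  (X - 1) * (Y - 1) * Y * G = (X - 1) * (Y - 1) * Y * Y +
    t * (((X - 1) * Y * (Y + X) * (g - f1) + Y * X * W * (X - 1) * (H - K)
      + X ^+ 2 * (Y - 1) * (G - H) - X * Y * (Y - 1) * (f - f1)) * g
     + X * Y * (Y - 1) * (f - f1) * G) ->
  (Y - 1) * (f * g - f * Y + Y * g) + t * W * Y * f * g * (H - K) = Y * (Y - 1) * H.
Proof.
move=> Xn0 X1n0 eX eY ek eG; apply/eqP; rewrite -subr_eq0; apply/eqP.
apply: (mulfI (mulf_neq0 X1n0 Xn0)); rewrite mulr0.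
pose dX := X * (X - 1) + t * X * (f - f1) * f - (X - 1) * f.
pose dY := Y * (Y - 1) + t * Y * (g - f1) * g - (Y - 1) * g.
pose dk := t * X * f * g - (X - 1) * Y.
pose dG := (X - 1) * (Y - 1) * Y * Y +
    t * (((X - 1) * Y * (Y + X) * (g - f1) + Y * X * W * (X - 1) * (H - K)
      + X ^+ 2 * (Y - 1) * (G - H) - X * Y * (Y - 1) * (f - f1)) * g
     + X * Y * (Y - 1) * (f - f1) * G) - (X - 1) * (Y - 1) * Y * G.
have dX0 : dX = 0 by rewrite /dX eX subrr.
have dY0 : dY = 0 by rewrite /dY eY subrr.
have dk0 : dk = 0 by rewrite /dk ek subrr.
have dG0 : dG = 0 by rewrite /dG eG subrr.
(* Explicit certificate: the relation sought, times $X(X-1)$, is a combination of the four equations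
   in which $G$ cancels. *)
have -> : (X - 1) * X * ((Y - 1) * (f * g - f * Y + Y * g) + t * W * Y * f * g * (H - K) - Y * (Y - 1) * H)
  = f * dG - Y * (Y - 1) * (G - g) * dX - f * (X - 1) * (Y + X) * dY - X * (Y - 1) * (G - H) * dk.
  by rewrite /dX /dY /dk /dG; ring.
by rewrite dX0 dY0 dk0 dG0 !mulr0 !subr0.
Qed.

(* The condition on [Y] cancels the coefficient of [H]. *)
Lemma kernel_second (R : idomainType) (t Y W f g H K : R) :
  Y - 1 != 0 -> Y - 1 = t * W * f * g ->
  (Y - 1) * (f * g - f * Y + Y * g) + t * W * Y * f * g * (H - K) = Y * (Y - 1) * H ->
  Y * K = f * g - f * Y + Y * g.
Proof.
move=> Y1n0 ek e; apply: (mulfI Y1n0).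
have -> : (Y - 1) * (f * g - f * Y + Y * g) =
   Y * (Y - 1) * H - t * W * Y * f * g * (H - K) by rewrite -e; ring.
have -> : t * W * Y * f * g * (H - K) = Y * (t * W * f * g) * (H - K) by ring.
by rewrite -ek; ring.
Qed.

(** The polynomial $C$ as an operation of any commutative ring, to be transported along morphisms
    between polynomials, series and fractions. *)
Definition cubic (R : comNzRingType) (h z w : R) : R :=
  w * z * (-1 + z) ^+ 9 * h ^+ 3
  + (-1 + z) ^+ 6 * (2%:R * w ^+ 2 * z ^+ 2 - w ^+ 2 * z + 2%:R * z ^+ 2 + w - z) * h ^+ 2
  - (-1 + z) ^+ 3 * (w ^+ 2 * z ^+ 3 - 3%:R * w ^+ 2 * z ^+ 2 - 2%:R * w * z ^+ 3
                     + w ^+ 2 * z - 2%:R * w * z ^+ 2 + z ^+ 3 + 5%:R * w * z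
                     - 3%:R * z ^+ 2 - 2%:R * w + z) * h
  + 4%:R * w * z ^+ 2 - 4%:R * w * z + w.

Lemma rmorph_cubic (R S : comNzRingType) (f : {rmorphism R -> S}) (h z w : R) :
  f (cubic h z w) = cubic (f h) (f z) (f w).
Proof. by rewrite /cubic !(rmorphM, rmorphD, rmorphN, rmorphXn, rmorph1, rmorph_nat). Qed.

(* The first kernel equation is quadratic in the parameter [U] of [X], but its
   discriminant is a square: [U = z b / D] is rational in [z] and [v]. *)
Section Parametrisation.
Variable R : fieldType.
Variables (z v : R).
Let D := 1 - 3%:R * z + z ^+ 2 - z ^+ 2 * v.
Let p := 1 - 2%:R * z - z ^+ 2 * v.
Let s := 1 - z.
Let b := 1 + z * v.
Let e := 1 - 3%:R * z - z ^+ 2 * v.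
Hypotheses (Dn0 : D != 0) (pn0 : p != 0) (sn0 : s != 0) (bn0 : b != 0).
Variables (t U X Y f g : R).
Hypotheses (tE : t = z * s ^+ 3) (UE : U * D = z * b).
Hypothesis XE : X * (1 + z * U) ^+ 2 = 1 + U.
Hypothesis fE : f * ((1 + z * U) * s ^+ 3) = (1 + U) * (1 - 2%:R * z - z ^+ 2 * U).
Hypothesis YE : Y * b ^+ 2 = 1 + v.
Hypothesis gE : g * (b * s ^+ 3) = (1 + v) * p.

Let UE' : U = z * b / D.
Proof. by rewrite -UE mulfK. Qed.

Let aE : 1 + z * U = s * p / D.
Proof. by move: Dn0; rewrite UE' /D => h; rewrite /s /p /b; field. Qed.

Let an0 : 1 + z * U != 0.
Proof. by rewrite aE !mulf_neq0 ?invr_neq0. Qed.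

Let XE' : X = D / p ^+ 2.
Proof.
apply: (mulIf (expf_neq0 2 an0)); rewrite XE aE UE'.
by move: Dn0 pn0; rewrite /p /D /s /b => h1 h2; field; rewrite h1 h2.
Qed.

Lemma param_f : f = e / (D * p).
Proof.
apply: (mulIf (mulf_neq0 an0 (expf_neq0 3 sn0))); rewrite fE aE UE'.
by move: Dn0 pn0; rewrite /p /D /s /b /e => h1 h2; field; rewrite h1 h2.
Qed.

Let YE' : Y = (1 + v) / b ^+ 2.
Proof. by rewrite -YE mulfK // expf_neq0. Qed.

Let gE' : g = (1 + v) * p / (b * s ^+ 3).
Proof. by rewrite -gE mulfK // mulf_neq0 ?expf_neq0. Qed.

Lemma param_kernel_first : (X - 1) * Y = t * X * f * g.
Proof.
rewrite param_f XE' YE' gE' tE.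
move: Dn0 pn0 sn0 bn0; rewrite /p /D /s /b /e => h1 h2 h3 h4.
by field; rewrite h1 h2 h3 h4.
Qed.

Lemma param_X_neq1 : z != 0 -> e != 0 -> X - 1 != 0.
Proof.
move=> zn0 en0; have -> : X - 1 = z * b * e / p ^+ 2.
  by rewrite XE'; move: Dn0 pn0; rewrite /p /D /b /e => h1 h2; field; rewrite h2.
by rewrite !mulf_neq0 ?invr_neq0 ?expf_neq0.
Qed.

Lemma param_X_neq0 : X != 0.
Proof. by rewrite XE' mulf_neq0 ?invr_neq0 ?expf_neq0. Qed.

Variables (w k : R).
Hypothesis vn1 : 1 + v != 0.
(** The second kernel equation $Y-1=twF(Y)F(X)$ in terms of $z$ and $v$, with denominators
    cleared. *)
Hypothesis vE : v * p * D = z * w * ((1 + v) * b * e).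

Lemma param_kernel_second : Y - 1 = t * w * f * g.
Proof.
have -> : t * w * f * g = (z * w * ((1 + v) * b * e)) / (D * b ^+ 2).
  rewrite param_f gE' tE; move: Dn0 pn0 sn0 bn0; rewrite /p /D /s /b /e => h1 h2 h3 h4.
  by field; rewrite h1 h2 h3 h4.
rewrite -vE YE'; move: Dn0 bn0; rewrite /p /D /b => h1 h4.
by field; rewrite h1 h4.
Qed.

Hypothesis kE : Y * k = f * g - f * Y + Y * g.

(** [k] stands for $G(1,1)$, which becomes rational in $z$ and $v$, without $w$. *)
Lemma param_k : f = e / (D * p) -> k = (1 + v) * (p ^+ 2 + z * e * b) / (s ^+ 3 * b * p).
Proof.
move=> fE'; have Yn0 : Y != 0 by rewrite YE' mulf_neq0 ?invr_neq0 ?expf_neq0.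
apply: (mulfI Yn0); rewrite kE fE' YE' gE'.
move: Dn0 pn0 sn0 bn0; rewrite /p /D /s /b /e => h1 h2 h3 h4.
by field; rewrite h1 h2 h3 h4.
Qed.

Lemma param_cubic : z != 0 -> e != 0 ->
  k = (1 + v) * (p ^+ 2 + z * e * b) / (s ^+ 3 * b * p) -> cubic k z w = 0.
Proof.
move=> zn0 en0 ->.
(* [vE] is linear in [w], so [w] is rational in [z] and [v] as well, and the cubic becomes an
   identity of rational functions. *)
have wE : w = v * p * D / (z * (1 + v) * b * e).
  rewrite vE; field. by rewrite zn0 vn1 bn0 en0.
rewrite wE.
move: Dn0 pn0 sn0 bn0 zn0 en0 vn1; rewrite /cubic /p /D /s /b /e => h1 h2 h3 h4 h5 h6 h7.
by field; rewrite h2 h3 h4 h5 h6 h7.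
Qed.

End Parametrisation.

(** * The kernel method in the fraction field of series *)

Section Kernel.
Variable A : idomainType.
Notation tf := (@FracField.tofrac (fps A)).
Implicit Types (X Y W z u v : fps A).

Definition rmorph_push := (rmorphM, rmorphD, rmorphN, rmorphXn, rmorph1, rmorph_nat).

(** Most factors to be inverted have the form $1+z(\cdots)$, hence constant term 1. *)
Lemma tofrac_neq0 (f : fps A) : f 0%N = 1 -> tf f != 0.
Proof.
move=> f0; rewrite tofrac_eq0; apply/eqP => e.
by have /eqP := f0; rewrite e fps0 eq_sym oner_eq0.
Qed.

Lemma one_plus0 z (f : fps A) : z 0%N = 0 -> (1 + z * f) 0%N = 1.
Proof. by move=> z0; rewrite fpsD fpsM0 z0 mul0r addr0 fps1. Qed.

Lemma z_neq0 z : is_z z -> z != 0.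
Proof.
case=> _ ez; apply/eqP => z0; have /eqP := congr1 (fun f : fps A => f 1%N) ez.
by rewrite z0 mul0r fps0 eq_sym oner_eq0.
Qed.

(* Value of [Feval X] at the root [X] of the first kernel attached to
   [y = (1 + v) / (1 + z v)^2]. *)
Definition kernel_value (K : fieldType) (z v : K) : K :=
  (1 - 3%:R * z - z ^+ 2 * v) /
  ((1 - 3%:R * z + z ^+ 2 - z ^+ 2 * v) * (1 - 2%:R * z - z ^+ 2 * v)).

Section Point.
Variables (z v Y : fps A).
Hypotheses (zz : is_z z) (vv : is_u z Y v).

Let z0 : z 0%N = 0 := proj1 zz.

Lemma kernelD_neq0 : 1 - 3%:R * tf z + tf z ^+ 2 - tf z ^+ 2 * tf v != 0.
Proof.
have := @tofrac_neq0 (1 + z * (- 3%:R + z - z * v)) (one_plus0 _ z0).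
by rewrite !rmorph_push; congr (_ != _); ring.
Qed.

Lemma kernelp_neq0 : 1 - 2%:R * tf z - tf z ^+ 2 * tf v != 0.
Proof.
have := @tofrac_neq0 (1 + z * (- 2%:R - z * v)) (one_plus0 _ z0).
by rewrite !rmorph_push; congr (_ != _); ring.
Qed.

Lemma kernele_neq0 : 1 - 3%:R * tf z - tf z ^+ 2 * tf v != 0.
Proof.
have := @tofrac_neq0 (1 + z * (- 3%:R - z * v)) (one_plus0 _ z0).
by rewrite !rmorph_push; congr (_ != _); ring.
Qed.

Lemma one_sub_z_neq0 : 1 - tf z != 0.
Proof.
have := @tofrac_neq0 (1 + z * (- 1)) (one_plus0 _ z0).
by rewrite !rmorph_push; congr (_ != _); ring.
Qed.

Lemma one_add_zv_neq0 : 1 + tf z * tf v != 0.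
Proof. by have := @tofrac_neq0 (1 + z * v) (one_plus0 _ z0); rewrite !rmorph_push. Qed.

Lemma tofrac_t : tf fpst = tf z * (1 - tf z) ^+ 3.
Proof. by rewrite -(proj2 zz) !rmorph_push. Qed.

Lemma tofrac_u X u : is_u z X u -> tf X * (1 + tf z * tf u) ^+ 2 = 1 + tf u.
Proof. by move=> /(congr1 tf); rewrite !rmorph_push. Qed.

Lemma tofrac_Feval X u : is_u z X u ->
  tf (Feval X) * ((1 + tf z * tf u) * (1 - tf z) ^+ 3)
  = (1 + tf u) * (1 - 2%:R * tf z - tf z ^+ 2 * tf u).
Proof. by move=> uu; apply: (rmorph_param tf (Feval_param zz uu)). Qed.

Lemma tofrac_Feval_eq X :
  (tf X - 1) * tf (Feval X) = tf X * (tf X - 1) + tf fpst * tf X * (tf (Feval X) - tf (Feval 1)) * tf (Feval X).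
Proof. by have := congr1 tf (Feval_eq X); rewrite !rmorph_push. Qed.

Lemma tofrac_Geval_eq W X :
  (tf X - 1) * (tf Y - 1) * tf Y * tf (Geval W X Y) = (tf X - 1) * (tf Y - 1) * tf Y * tf Y +
    tf fpst * (((tf X - 1) * tf Y * (tf Y + tf X) * (tf (Feval Y) - tf (Feval 1))
      + tf Y * tf X * tf W * (tf X - 1) * (tf (Geval W 1 Y) - tf (Geval W 1 1))
      + tf X ^+ 2 * (tf Y - 1) * (tf (Geval W X Y) - tf (Geval W 1 Y))
      - tf X * tf Y * (tf Y - 1) * (tf (Feval X) - tf (Feval 1))) * tf (Feval Y)
     + tf X * tf Y * (tf Y - 1) * (tf (Feval X) - tf (Feval 1)) * tf (Geval W X Y)).
Proof. by have := congr1 tf (Geval_eq W X Y); rewrite !rmorph_push. Qed.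

(** The series $U=z(1+zv)/(1-3z+z^2-z^2v)$ and its [X] solve the first kernel equation, and [f] is
    $F(X)$. The last clause turns the equation of [second_kernel_exists] for [v] into the condition
    on [Y] in [kernel_second]. *)
Lemma series_kernel W : exists f : fps A, [/\ tf f = kernel_value (tf z) (tf v),
  (tf Y - 1) * (tf f * tf (Feval Y) - tf f * tf Y + tf Y * tf (Feval Y))
    + tf fpst * tf W * tf Y * tf f * tf (Feval Y) * (tf (Geval W 1 Y) - tf (Geval W 1 1))
  = tf Y * (tf Y - 1) * tf (Geval W 1 Y) &
  (v * (1 - 2%:R * z - z ^+ 2 * v) * (1 - 3%:R * z + z ^+ 2 - z ^+ 2 * v) =
   z * W * ((1 + v) * (1 + z * v) * (1 - 3%:R * z - z ^+ 2 * v)) ->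
   tf Y - 1 = tf fpst * tf W * tf f * tf (Feval Y))].
Proof.
have [d ed] := fps_inv (one_plus0 (- 3%:R + z - z * v) z0).
pose U := z * (1 + z * v) * d.
have [a ea] := fps_inv (one_plus0 U z0).
pose X := (1 + U) * a ^+ 2.
have UE : U * (1 - 3%:R * z + z ^+ 2 - z ^+ 2 * v) = z * (1 + z * v).
  transitivity (z * (1 + z * v) * ((1 + z * (- 3%:R + z - z * v)) * d)).
    by rewrite /U; ring.
  by rewrite ed mulr1.
have UX : is_u z X U.
  transitivity ((1 + U) * ((1 + z * U) * a) ^+ 2); first by rewrite /X; ring.
  by rewrite ea expr1n mulr1.
have tUE : tf U * (1 - 3%:R * tf z + tf z ^+ 2 - tf z ^+ 2 * tf v) = tf z * (1 + tf z * tf v).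
  by have := congr1 tf UE; rewrite !rmorph_push.
have fE := tofrac_Feval UX; have gE := tofrac_Feval vv; have XE := tofrac_u UX; have YE := tofrac_u vv.
exists (Feval X); split.
- exact: (param_f kernelD_neq0 kernelp_neq0 one_sub_z_neq0 tUE fE).
- have Xn0 := param_X_neq0 kernelD_neq0 kernelp_neq0 one_sub_z_neq0 tUE XE.
  have znz : tf z != 0 by rewrite tofrac_eq0 z_neq0.
  have X1n0 := param_X_neq1 kernelD_neq0 kernelp_neq0 one_sub_z_neq0 one_add_zv_neq0 tUE XE znz kernele_neq0.
  have ek := param_kernel_first kernelD_neq0 kernelp_neq0 one_sub_z_neq0 one_add_zv_neq0 tofrac_t tUE XE fE YE gE.
  exact: (kernel_first Xn0 X1n0 (tofrac_Feval_eq X) (tofrac_Feval_eq Y) ek (tofrac_Geval_eq W X)).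
- move=> /(congr1 tf); rewrite !rmorph_push => vE.
  exact: (param_kernel_second kernelD_neq0 kernelp_neq0 one_sub_z_neq0 one_add_zv_neq0 tofrac_t tUE fE YE gE vE).
Qed.

End Point.

(** Expanding, the left-hand side is [v] minus a multiple of [z], so the equation reads
    $v=z(\cdots)$, a contraction. *)
Lemma second_kernel_exists z W : z 0%N = 0 -> exists2 v : fps A, v 0%N = 0 &
  v * (1 - 2%:R * z - z ^+ 2 * v) * (1 - 3%:R * z + z ^+ 2 - z ^+ 2 * v) =
  z * W * ((1 + v) * (1 + z * v) * (1 - 3%:R * z - z ^+ 2 * v)).
Proof.
move=> z0.
have [v ev] : {v : fps A | z * (v * (5%:R - 7%:R * z + 2%:R * z ^+ 2 + 2%:R * z * v - 5%:R * z ^+ 2 * v + z ^+ 3 * v - z ^+ 3 * v ^+ 2)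
    + W * ((1 + v) * (1 + z * v) * (1 - 3%:R * z - z ^+ 2 * v))) = v}.
  apply: contractive_fix => n f g efg; apply: eqmodt_mull => //.
  by do !(apply: eqmodtD || apply: eqmodtM || apply: eqmodtX || apply: eqmodtN || exact: efg || exact: eqmodt_refl).
exists v; first by rewrite -ev fpsM0 z0 mul0r.
apply/eqP; rewrite -subr_eq0; apply/eqP.
transitivity (v - z * (v * (5%:R - 7%:R * z + 2%:R * z ^+ 2 + 2%:R * z * v - 5%:R * z ^+ 2 * v + z ^+ 3 * v - z ^+ 3 * v ^+ 2)
    + W * ((1 + v) * (1 + z * v) * (1 - 3%:R * z - z ^+ 2 * v)))); first by ring.
by rewrite ev subrr.
Qed.

(** Both kernels are cancelled at once: [v] solves the second equation, [Y] is built from [v], and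
    [series_kernel] supplies the matching $F(X)$. *)
Lemma G11_param z W : is_z z -> W != 0 -> exists v : fps A,
  [/\ 1 + tf v != 0,
   tf v * (1 - 2%:R * tf z - tf z ^+ 2 * tf v) * (1 - 3%:R * tf z + tf z ^+ 2 - tf z ^+ 2 * tf v) =
   tf z * tf W * ((1 + tf v) * (1 + tf z * tf v) * (1 - 3%:R * tf z - tf z ^+ 2 * tf v)) &
   tf (Geval W 1 1) = (1 + tf v) * ((1 - 2%:R * tf z - tf z ^+ 2 * tf v) ^+ 2
     + tf z * (1 - 3%:R * tf z - tf z ^+ 2 * tf v) * (1 + tf z * tf v))
     / ((1 - tf z) ^+ 3 * (1 + tf z * tf v) * (1 - 2%:R * tf z - tf z ^+ 2 * tf v))].
Proof.
move=> zz Wn0; have z0 := proj1 zz; have [v v0 vE] := second_kernel_exists W z0.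
have tv1 : 1 + tf v != 0.
  by have := @tofrac_neq0 (1 + v); rewrite !rmorph_push; apply; rewrite fpsD v0 fps1 addr0.
have tvE : tf v * (1 - 2%:R * tf z - tf z ^+ 2 * tf v) * (1 - 3%:R * tf z + tf z ^+ 2 - tf z ^+ 2 * tf v) =
   tf z * tf W * ((1 + tf v) * (1 + tf z * tf v) * (1 - 3%:R * tf z - tf z ^+ 2 * tf v)).
  by have := congr1 tf vE; rewrite !rmorph_push.
exists v; split=> //.
have [a ea] := fps_inv (one_plus0 v z0).
pose Y := (1 + v) * a ^+ 2.
have vv : is_u z Y v.
  transitivity ((1 + v) * ((1 + z * v) * a) ^+ 2); first by rewrite /Y; ring.
  by rewrite ea expr1n mulr1.
have [f [fE K1 /(_ vE) K2]] := series_kernel zz vv W.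
have znz : tf z != 0 by rewrite tofrac_eq0 z_neq0.
have Wnz : tf W != 0 by rewrite tofrac_eq0.
have YE := tofrac_u vv.
(* [v = 0] would annihilate the left side of [tvE], while its right side is nonzero because [W]
   is. *)
have vn0 : tf v != 0.
  apply/eqP => e0; have := mulf_neq0 (mulf_neq0 znz Wnz)
    (mulf_neq0 (mulf_neq0 tv1 (one_add_zv_neq0 v zz)) (kernele_neq0 v zz)).
  by rewrite -tvE e0 !mul0r eqxx.
(* $Y=1$ would mean $(1+zv)^2=1+v$, that is $v(1-2z-z^2v)=0$. *)
have Y1n0 : tf Y - 1 != 0.
  apply: (contraNneq _ vn0) => Y1; have Y1' : tf Y = 1 by apply/eqP; rewrite -subr_eq0 Y1.
  move: YE; rewrite Y1' mul1r => e1.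
  have : tf v * (1 - 2%:R * tf z - tf z ^+ 2 * tf v) = 0.
    by rewrite -[RHS](subrr (1 + tf v)) -{2}e1; ring.
  by move/eqP; rewrite mulf_eq0 (negPf (kernelp_neq0 v zz)) orbF.
have kE := kernel_second Y1n0 K2 K1.
have gE := tofrac_Feval zz vv.
have Dn0 := kernelD_neq0 v zz; have pn0 := kernelp_neq0 v zz; have sn0 := one_sub_z_neq0 zz; have bn0 := one_add_zv_neq0 v zz.
move: fE YE gE kE tv1 Dn0 pn0 sn0 bn0; rewrite /kernel_value.
move: (tf z) (tf v) (tf Y) (tf f) (tf (Feval Y)) (tf (Geval W 1 1)) => z1 v1 Y1 f1 g1 k1.
move=> fE YE gE kE tv1 Dn0 pn0 sn0 bn0.
exact: (param_k Dn0 pn0 sn0 bn0 YE gE tv1 kE fE).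
Qed.

Lemma G11_cubic z W : is_z z -> W != 0 -> cubic (Geval W 1 1) z W = 0.
Proof.
move=> zz Wn0; have [v [tv1 vE kE]] := G11_param zz Wn0.
have znz : tf z != 0 by rewrite tofrac_eq0 z_neq0.
apply/eqP; rewrite -tofrac_eq0 rmorph_cubic; apply/eqP.
exact: (param_cubic (kernelD_neq0 v zz) (kernelp_neq0 v zz) (one_sub_z_neq0 zz) (one_add_zv_neq0 v zz) tv1 vE znz (kernele_neq0 v zz) kE).
Qed.

End Kernel.

(** * Algebraicity *)

Section PolyEval.
Variable A : comNzRingType.
Implicit Types (p : {poly A}) (f z h : fps A).

Lemma pevalE p z : peval p z = (map_poly (@fpsC A) p).[z].
Proof.
rewrite (horner_coef_wide _ (size_poly _ _)) /peval.
by apply: eq_bigr => k _; rewrite coef_map spowE.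
Qed.

Fact ser_of_poly_is_zmod_morphism : zmod_morphism (@ser_of_poly A : {poly A} -> fps A).
Proof. by move=> p q; apply: fpsP => n; rewrite /ser_of_poly coefB. Qed.
Fact ser_of_poly_is_monoid_morphism : monoid_morphism (@ser_of_poly A : {poly A} -> fps A).
Proof.
split; first by apply: fpsP => n; rewrite /ser_of_poly coef1 fps1.
by move=> p q; apply: fpsP => n; rewrite /ser_of_poly coefM fpsM.
Qed.
Definition poly_fps (p : {poly A}) : fps A := ser_of_poly p.
HB.instance Definition _ := GRing.isZmodMorphism.Build {poly A} (fps A) poly_fps
  ser_of_poly_is_zmod_morphism.
HB.instance Definition _ := GRing.isMonoidMorphism.Build {poly A} (fps A) poly_fps
  ser_of_poly_is_monoid_morphism.

Lemma poly_fps_inj : injective poly_fps.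
Proof. by move=> p q e; apply/polyP => n; have := congr1 (fun f : fps A => f n) e. Qed.

Lemma poly_fpsX : poly_fps 'X = fpst.
Proof. by apply: fpsP => n; rewrite /poly_fps /ser_of_poly coefX /fpst /tser; case: eqP. Qed.

Lemma poly_fpsC a : poly_fps a%:P = fpsC a.
Proof. by apply: fpsP => n; rewrite /poly_fps /ser_of_poly coefC /fpsC /sconst. Qed.

Lemma algebraic_serP (F : fps A) (Q : {poly {poly A}}) :
  Q != 0 -> (map_poly poly_fps Q).[F] = 0 -> algebraic_ser F.
Proof.
move=> Qn0 e; exists Q; split=> // n; transitivity ((map_poly poly_fps Q).[F] n); last by rewrite e.
congr (_ n); rewrite (horner_coef_wide _ (size_poly _ _)).
by apply: eq_bigr => k _; rewrite coef_map spowE.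
Qed.

End PolyEval.

(** The nested evaluation is one ring morphism [psi], and [Cpoly] is by definition [cubic] at the
    three indeterminates. *)
Lemma CevalE (h z : fps {poly rat}) : Ceval h z = cubic h z (fpsC 'X).
Proof.
pose psi1 : {rmorphism {poly {poly rat}} -> fps {poly rat}} := horner_eval z \o map_poly (@fpsC _).
pose psi : {rmorphism {poly {poly {poly rat}}} -> fps {poly rat}} := horner_eval h \o map_poly psi1.
have psiC p : psi p%:P = psi1 p.
  exact: etrans (congr1 (horner_eval h) (map_polyC psi1 p)) (hornerC _ _).
have psi1C p : psi1 p%:P = fpsC p.
  exact: etrans (congr1 (horner_eval z) (map_polyC (@fpsC _) p)) (hornerC _ _).
have psiX : psi 'X = h.
  exact: etrans (congr1 (horner_eval h) (map_polyX psi1)) (hornerX _).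
have psi1X : psi1 'X = z.
  exact: etrans (congr1 (horner_eval z) (map_polyX (@fpsC _))) (hornerX _).
transitivity (psi Cpoly).
  rewrite -[RHS]/((map_poly psi1 Cpoly).[h]) (horner_coef_wide _ (size_poly _ _)).
  by apply: eq_bigr => k _; rewrite coef_map spowE pevalE.
rewrite -[Cpoly]/(cubic 'X 'X%:P 'X%:P%:P) (rmorph_cubic psi).
by rewrite psiX !psiC psi1X psi1C.
Qed.

Lemma G11serE : G11ser = Gxyser 'X 1 1 :> fps {poly rat}.
Proof.
apply: fpsP => n; rewrite /Gxyser -Gsum_intervals.
by do 3!(apply: eq_bigr => ? _); rewrite !expr1n !mulr1.
Qed.

Lemma GserE : Gser = Gxyser vw vx vy :> fps {mpoly rat[3]}.
Proof. by apply: fpsP => n; rewrite /Gxyser -Gsum_intervals. Qed.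

Lemma G11_root (z : nat -> rat) (zs : ser {poly rat} := fun n => (z n)%:P) :
  z 0%N = 0 -> (forall n, smul zs (spow (sadd (@sone _) (sneg zs)) 3) n = @tser _ n) ->
  forall n, Ceval G11ser zs n = 0.
Proof.
move=> z0 ez n.
have zz : is_z (zs : fps _).
  by split; [rewrite /zs z0|apply: fpsP => k; apply: etrans (ez k); rewrite -spowE].
have Wn0 : fpsC 'X != 0 :> fps {poly rat}.
  apply/eqP => /(congr1 (fun f : fps {poly rat} => f 0%N)) /eqP; rewrite fps0.
  by rewrite [_ == _](polyX_eq0 rat).
have := Geval_C ('X : {poly rat}) 1 1; rewrite rmorph1 -G11serE => gE.
by have := G11_cubic zz Wn0; rewrite gE -CevalE => ->.
Qed.

(** * Extension of an embedding to the fraction field *)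

Section FracMap.
Variables (R : idomainType) (E : fieldType) (iota : {rmorphism R -> E}).
Hypothesis iota_inj : injective iota.
Local Notation tf := (@FracField.tofrac R).

Definition frac_num (x : {fraction R}) : R := \n_(repr x).
Definition frac_den (x : {fraction R}) : R := \d_(repr x).

Lemma frac_den_neq0 x : frac_den x != 0. Proof. exact: denom_ratioP. Qed.

Lemma frac_numden x : x = tf (frac_num x) / tf (frac_den x).
Proof.
have dn0 : tf (frac_den x) != 0 by rewrite tofrac_eq0 frac_den_neq0.
apply: (mulIf dn0); rewrite divfK //.
rewrite /frac_num /frac_den -{1}[x]reprK; move: (repr x) => y; unlock FracField.tofrac.
rewrite -[LHS]FracField.pi_mul; apply/eqmodP; rewrite /= FracField.equivfE /FracField.mulf.
rewrite !numden_Ratio ?mulf_neq0 ?oner_neq0 ?denom_ratioP //.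
by rewrite !mulr1 mulrC.
Qed.

(** Taking the injectivity proof as an argument ties the function to the morphism instances that
    rest on it. *)
Definition frac_map (inj : injective iota) (x : {fraction R}) : E :=
  iota (frac_num x) / iota (frac_den x).
Local Notation fmap := (frac_map iota_inj).

Lemma iota_neq0 a : a != 0 -> iota a != 0.
Proof. by move=> an0; rewrite -(rmorph0 iota) (inj_eq iota_inj). Qed.

Lemma frac_mapE a b : b != 0 -> fmap (tf a / tf b) = iota a / iota b.
Proof.
move=> bn0; set x := tf a / tf b; have dn0 := frac_den_neq0 x.
have := frac_numden x; rewrite {1}/x => /eqP.
rewrite eqr_div ?tofrac_eq0 // -!rmorphM tofrac_eq => /eqP e.
by apply/eqP; rewrite /frac_map eqr_div ?iota_neq0 // -!rmorphM e.
Qed.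

Fact frac_map_is_zmod_morphism : zmod_morphism fmap.
Proof.
move=> x y; rewrite {1}[x]frac_numden {1}[y]frac_numden -mulNr addf_div ?tofrac_eq0 ?frac_den_neq0 //.
rewrite -rmorphN -!rmorphM -rmorphD frac_mapE ?mulf_neq0 ?frac_den_neq0 //.
rewrite !(rmorphM, rmorphD, rmorphN) /frac_map -mulNr addf_div ?iota_neq0 ?frac_den_neq0 //.
Qed.

Fact frac_map_is_monoid_morphism : monoid_morphism fmap.
Proof.
split.
  by rewrite -[1](divr1 1) -(rmorph1 tf) frac_mapE ?oner_neq0 // rmorph1 divr1.
move=> x y; rewrite {1}[x]frac_numden {1}[y]frac_numden mulf_div -!rmorphM.
by rewrite frac_mapE ?mulf_neq0 ?frac_den_neq0 // !rmorphM -mulf_div.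
Qed.

HB.instance Definition _ := GRing.isZmodMorphism.Build {fraction R} E fmap
  frac_map_is_zmod_morphism.
HB.instance Definition _ := GRing.isMonoidMorphism.Build {fraction R} E fmap
  frac_map_is_monoid_morphism.

Lemma frac_map_tf a : fmap (tf a) = iota a.
Proof. by rewrite -[tf a]divr1 -(rmorph1 tf) frac_mapE ?oner_neq0 // rmorph1 divr1. Qed.

Lemma clear_denominators (p : {poly {fraction R}}) :
  exists2 c, c != 0 & exists Q, tf c *: p = map_poly tf Q.
Proof.
elim/poly_ind: p => [|p a [c cn0 [Q eQ]]].
  by exists 1; rewrite ?oner_neq0 //; exists 0; rewrite scaler0 rmorph0.
exists (c * frac_den a); first by rewrite mulf_neq0 ?frac_den_neq0.
exists (frac_den a *: Q * 'X + (c * frac_num a)%:P).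
rewrite [in RHS]rmorphD [in RHS]rmorphM /= map_polyX map_polyC map_polyZ /= -eQ scalerA.
rewrite scalerDr scalerAl -rmorphM [_ * c]mulrC; congr (_ + _).
rewrite -mul_polyC -polyCM; congr (_%:P).
have e : tf (frac_den a) * a = tf (frac_num a).
  by rewrite {2}[a]frac_numden mulrC divfK // tofrac_eq0 frac_den_neq0.
by rewrite !rmorphM /= -mulrA e.
Qed.

(** Algebraicity over a field has the closure properties, whereas [algebraic_ser] asks for
    coefficients in a polynomial ring; clearing denominators passes from one to the other. *)
Lemma algebraic_frac_map (u : E) : algebraicOver fmap u ->
  exists2 Q : {poly R}, Q != 0 & (map_poly iota Q).[u] = 0.
Proof.
case=> p pn0 /eqP pu; have [c cn0 [Q eQ]] := clear_denominators p.
have eQ' : map_poly iota Q = iota c *: map_poly fmap p.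
  rewrite -frac_map_tf -map_polyZ eQ -map_poly_comp /=.
  by apply: eq_map_poly => a /=; rewrite frac_map_tf.
exists Q; last by rewrite eQ' hornerZ pu mulr0.
apply: contra_neq pn0 => Q0; apply/eqP.
have : tf c *: p == 0 by rewrite eQ Q0 rmorph0.
by rewrite scaler_eq0 tofrac_eq0 (negPf cn0).
Qed.

End FracMap.

(** * Algebraicity of each quantity in turn *)

Section AlgebraicElements.
Variables (F E : fieldType) (phi : {rmorphism F -> E}).
Local Notation alg := (algebraicOver phi).
Implicit Types (p q : {poly E}) (u v x y z t w : E).

Lemma algebraic_nat n : alg n%:R.
Proof. by rewrite -(rmorph_nat phi); apply: algebraic_id. Qed.

Lemma algebraic_exp u n : alg u -> alg (u ^+ n).
Proof.
by move=> au; elim: n => [|n IH]; [exact: algebraic1|rewrite exprS; apply: algebraic_mul].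
Qed.

Definition polyalg p := forall i, alg p`_i.

Lemma polyalgC u : alg u -> polyalg u%:P.
Proof. by move=> au i; rewrite coefC; case: ifP => // _; apply: algebraic0. Qed.
Lemma polyalgX : polyalg 'X.
Proof. by move=> i; rewrite coefX; apply: algebraic_nat. Qed.
Lemma polyalgD p q : polyalg p -> polyalg q -> polyalg (p + q).
Proof. by move=> ap aq i; rewrite coefD; apply: algebraic_add. Qed.
Lemma polyalgN p : polyalg p -> polyalg (- p).
Proof. by move=> ap i; rewrite coefN; apply: algebraic_opp. Qed.
Lemma polyalgM p q : polyalg p -> polyalg q -> polyalg (p * q).
Proof.
move=> ap aq i; rewrite coefM; elim/big_rec: _ => [|j u _ au]; first exact: algebraic0.
by apply: algebraic_add => //; apply: algebraic_mul.
Qed.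
Lemma polyalg1 : polyalg 1. Proof. by apply: polyalgC; apply: algebraic1. Qed.
Lemma polyalg_exp p n : polyalg p -> polyalg (p ^+ n).
Proof. by move=> ap; elim: n => [|n IH]; [exact: polyalg1|rewrite exprS; apply: polyalgM]. Qed.

(** The point [c] witnesses that [p] is nonzero; the uses below take [c = 0], where only the
    constant coefficient remains. *)
Lemma algebraic_root p u c : polyalg p -> p.[u] = 0 -> p.[c] != 0 -> alg u.
Proof.
move=> ap pu pc; apply/integral_algebraic.
apply: (integral_root (p := p)); first by apply: contra_neq pc => ->; rewrite horner0.
  exact/eqP.
by apply/integral_poly => i; apply/integral_algebraic; apply: ap.
Qed.

Ltac alg_tac := repeat first [assumption | exact: algebraic1 | exact: algebraic0
  | exact: algebraic_nat | apply: algebraic_add | apply: algebraic_opp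
  | apply: algebraic_mul | apply: algebraic_inv | apply: algebraic_exp].
Ltac polyalg_tac := repeat first [exact: polyalg1 | exact: polyalgX
  | apply: polyalgC; solve [alg_tac]
  | apply: polyalgD | apply: polyalgN | apply: polyalgM | apply: polyalg_exp].

Lemma algebraic_z z t : z * (1 - z) ^+ 3 = t -> t != 0 -> alg t -> alg z.
Proof.
move=> e t0 a; apply: (@algebraic_root ('X * (1 - 'X) ^+ 3 - t%:P) _ 0).
- by polyalg_tac.
- by rewrite -[RHS](subrr t) -{1}e !hornerE; ring.
by rewrite (_ : _.[0] = - t) ?oppr_eq0 // !hornerE; ring.
Qed.

Lemma algebraic_u z x u : x * (1 + z * u) ^+ 2 = 1 + u -> x != 1 -> alg z -> alg x -> alg u.
Proof.
move=> e x1 az ax; apply: (@algebraic_root (x%:P * (1 + z%:P * 'X) ^+ 2 - (1 + 'X)) _ 0).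
- by polyalg_tac.
- by rewrite -[RHS](subrr (1 + u)) -{1}e !hornerE; ring.
by rewrite (_ : _.[0] = x - 1) ?subr_eq0 // !hornerE /=; ring.
Qed.

Lemma algebraic_v z w v :
  v * (1 - 2%:R * z - z ^+ 2 * v) * (1 - 3%:R * z + z ^+ 2 - z ^+ 2 * v) =
  z * w * ((1 + v) * (1 + z * v) * (1 - 3%:R * z - z ^+ 2 * v)) ->
  z * w * (1 - 3%:R * z) != 0 -> alg z -> alg w -> alg v.
Proof.
move=> e n0 az aw.
apply: (@algebraic_root ('X * (1 - (2%:R * z)%:P - (z ^+ 2)%:P * 'X) *
    (1 - (3%:R * z)%:P + (z ^+ 2)%:P - (z ^+ 2)%:P * 'X) -
  (z * w)%:P * ((1 + 'X) * (1 + z%:P * 'X) * (1 - (3%:R * z)%:P - (z ^+ 2)%:P * 'X))) _ 0).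
- by polyalg_tac.
- move/eqP: e; rewrite -subr_eq0 => /eqP e; rewrite -[RHS]e !hornerE; ring.
by rewrite (_ : _.[0] = - (z * w * (1 - 3%:R * z))) ?oppr_eq0 // !hornerE /=; ring.
Qed.

Lemma algebraic_F z u f : f * ((1 + z * u) * (1 - z) ^+ 3) = (1 + u) * (1 - 2%:R * z - z ^+ 2 * u) ->
  1 + z * u != 0 -> 1 - z != 0 -> alg z -> alg u -> alg f.
Proof.
move=> e n1 n2 az au; rewrite -(mulfK (mulf_neq0 n1 (expf_neq0 3 n2)) f) e; by alg_tac.
Qed.

Lemma algebraic_k z v : alg z -> alg v ->
  alg ((1 + v) * ((1 - 2%:R * z - z ^+ 2 * v) ^+ 2
     + z * (1 - 3%:R * z - z ^+ 2 * v) * (1 + z * v))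
     / ((1 - z) ^+ 3 * (1 + z * v) * (1 - 2%:R * z - z ^+ 2 * v))).
Proof. by move=> az av; alg_tac. Qed.

Lemma algebraic_kernel_value z v : alg z -> alg v -> alg (kernel_value z v).
Proof. by move=> az av; rewrite /kernel_value; alg_tac. Qed.

(** The relation is linear in [h] with coefficient nonzero by the second hypothesis, so [h] is a
    quotient of algebraic elements. [algebraic_G] proceeds in the same way. *)
Lemma algebraic_H t w y f g h k :
  (y - 1) * (f * g - f * y + y * g) + t * w * y * f * g * (h - k) = y * (y - 1) * h ->
  y * (y - 1) - t * (w * y * f * g) != 0 ->
  alg t -> alg w -> alg y -> alg f -> alg g -> alg k -> alg h.
Proof.
move=> e n0 at_ aw ay af ag ak; rewrite -(mulfK n0 h).
have -> : h * (y * (y - 1) - t * (w * y * f * g)) =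
    (y - 1) * (f * g - f * y + y * g) - t * w * y * f * g * k.
  apply/eqP; rewrite -subr_eq0 -[X in _ == X](subrr (y * (y - 1) * h)) -{2}e; apply/eqP; ring.
by alg_tac.
Qed.

Lemma algebraic_G t w x y f g f1 G h k :
  (x - 1) * (y - 1) * y * G = (x - 1) * (y - 1) * y * y +
    t * (((x - 1) * y * (y + x) * (g - f1) + y * x * w * (x - 1) * (h - k)
      + x ^+ 2 * (y - 1) * (G - h) - x * y * (y - 1) * (f - f1)) * g
     + x * y * (y - 1) * (f - f1) * G) ->
  (x - 1) * (y - 1) * y - t * (x ^+ 2 * (y - 1) * g + x * y * (y - 1) * (f - f1)) != 0 ->
  alg t -> alg w -> alg x -> alg y -> alg f -> alg g -> alg f1 -> alg h -> alg k -> alg G.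
Proof.
move=> e n0 at_ aw ax ay af ag af1 ah ak; rewrite -(mulfK n0 G).
have -> : G * ((x - 1) * (y - 1) * y - t * (x ^+ 2 * (y - 1) * g + x * y * (y - 1) * (f - f1))) =
   (x - 1) * (y - 1) * y * y +
    t * (((x - 1) * y * (y + x) * (g - f1) + y * x * w * (x - 1) * (h - k)
      - x ^+ 2 * (y - 1) * h - x * y * (y - 1) * (f - f1)) * g).
  apply/eqP; rewrite -subr_eq0 -[X in _ == X](subrr ((x - 1) * (y - 1) * y * G)) {2}e; apply/eqP; ring.
by alg_tac.
Qed.

End AlgebraicElements.

(** * Algebraicity of $G(x,y)$ over polynomials in $t$ *)

Section AlgebraicSeries.
Variable A : idomainType.
Let K := {fraction (fps A)}.
Notation tf := (@FracField.tofrac (fps A)).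
Let iota : {rmorphism {poly A} -> K} := tf \o @poly_fps A.

Fact iota_inj : injective iota.
Proof.
move=> p q /eqP; rewrite /= tofrac_eq => /eqP; exact: poly_fps_inj.
Qed.

Let phi : {rmorphism {fraction {poly A}} -> K} := frac_map iota_inj.
Local Notation alg := (algebraicOver phi).

Lemma algebraic_ser_of_frac (F : fps A) : alg (tf F) -> algebraic_ser F.
Proof.
move=> /algebraic_frac_map[Q Qn0 e]; apply: (algebraic_serP Qn0).
apply/eqP; rewrite -tofrac_eq0 -horner_map -map_poly_comp; apply/eqP.
by rewrite -[RHS]e.
Qed.

Lemma algebraic_poly_fps p : alg (tf (poly_fps p)).
Proof.
have := algebraic_id phi (@FracField.tofrac _ p).
by rewrite [phi _]frac_map_tf.
Qed.

Lemma algebraic_fpst : alg (tf fpst).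
Proof. by rewrite -(poly_fpsX A); apply: algebraic_poly_fps. Qed.

Lemma algebraic_fpsC a : alg (tf (fpsC a)).
Proof. by rewrite -poly_fpsC; apply: algebraic_poly_fps. Qed.

Lemma coef_neq0 (f : fps A) n : f n != 0 -> tf f != 0.
Proof. by rewrite tofrac_eq0; apply: contra_neq => ->; rewrite fps0. Qed.

(** Algebraicity climbs from $t$ to $z$, then to the parameters $u$, $v$ of $x$, $y$, to the values
    of $F$, to $G(1,1)$, $G(1,y)$ and finally $G(x,y)$. *)
Lemma algebraic_Gxyser (w x y : A) : w != 0 -> x != 1 -> y != 0 -> y != 1 ->
  alg (tf (Gxyser w x y)).
Proof.
move=> wn0 x1 yn0 y1; rewrite -Geval_C.
have [z zz] := is_z_exists A; have z0 := proj1 zz.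
have C1 (c : A) : c != 1 -> tf (fpsC c) != 1.
  move=> c1; rewrite -subr_eq0 -(rmorph1 tf) -rmorphB; apply: (@coef_neq0 _ 0%N).
  by rewrite fpsB fps1 subr_eq0.
have C0 (c : A) : c != 0 -> tf (fpsC c) != 0 by move=> c0; apply: (@coef_neq0 _ 0%N).
have tn0 : tf fpst != 0 by apply: (@coef_neq0 _ 1%N); apply: oner_neq0.
have znz : tf z != 0 by rewrite tofrac_eq0 z_neq0.
have at_ := algebraic_fpst.
have az : alg (tf z) := algebraic_z (esym (tofrac_t zz)) tn0 at_.
have aX := algebraic_fpsC x; have aY := algebraic_fpsC y; have aW := algebraic_fpsC w.
have [u uu] := is_u_exists (fpsC x) z0; have [v vv] := is_u_exists (fpsC y) z0.
have au := algebraic_u (tofrac_u uu) (C1 _ x1) az aX.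
have av := algebraic_u (tofrac_u vv) (C1 _ y1) az aY.
have aFX := algebraic_F (tofrac_Feval zz uu) (one_add_zv_neq0 u zz) (one_sub_z_neq0 zz) az au.
have aFY := algebraic_F (tofrac_Feval zz vv) (one_add_zv_neq0 v zz) (one_sub_z_neq0 zz) az av.
(* The argument $X=1$ has parameter 0. *)
have u1 : is_u z 1 0 by rewrite /is_u mulr0 addr0 expr1n mulr1.
have a0 : alg (tf 0) by rewrite rmorph0; apply: algebraic0.
have aF1 := algebraic_F (tofrac_Feval zz u1) (one_add_zv_neq0 0 zz) (one_sub_z_neq0 zz) az a0.
have aK : alg (tf (Geval (fpsC w) 1 1)).
  have Wn0 : fpsC w != 0 by rewrite -tofrac_eq0; apply: C0.
  have [v' [_ vE ->]] := G11_param zz Wn0.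
  (* At $v=0$ this factor is $1-3z$, which enters the constant coefficient of the equation for
     [v']. *)
  have en0 := kernele_neq0 0 zz; rewrite rmorph0 mulr0 subr0 in en0.
  have Wnz : tf (fpsC w) != 0 by apply: C0.
  exact: algebraic_k az (algebraic_v vE (mulf_neq0 (mulf_neq0 znz Wnz) en0) az aW).
have [f [fE eH _]] := series_kernel zz vv (fpsC w).
have af : alg (tf f) by rewrite fE; exact: algebraic_kernel_value az av.
have aH : alg (tf (Geval (fpsC w) 1 (fpsC y))).
  (* The coefficient of $t^0$ is $y(y-1)$, which is nonzero; likewise $(x-1)(y-1)y$ for the
     coefficient of $G(x,y)$ below. *)
  have n0 : tf (fpsC y * (fpsC y - 1) - fpst * (fpsC w * fpsC y * f * Feval (fpsC y))) != 0.
    apply: (@coef_neq0 _ 0%N); rewrite fpsB !fpsM0 mul0r subr0 fpsB fps1.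
    by rewrite mulf_neq0 ?subr_eq0.
  rewrite !rmorph_push in n0.
  exact: (algebraic_H eH n0 at_ aW aY af aFY aK).
have n0 : tf ((fpsC x - 1) * (fpsC y - 1) * fpsC y - fpst * (fpsC x ^+ 2 * (fpsC y - 1) * Feval (fpsC y)
     + fpsC x * fpsC y * (fpsC y - 1) * (Feval (fpsC x) - Feval 1))) != 0.
  apply: (@coef_neq0 _ 0%N); rewrite fpsB !fpsM0 mul0r subr0 !fpsB fps1.
  by rewrite !mulf_neq0 ?subr_eq0.
rewrite !rmorph_push in n0.
exact: (algebraic_G (tofrac_Geval_eq (fpsC y) (fpsC w) (fpsC x)) n0 at_ aW aX aY aFX aFY aF1 aH aK).
Qed.

End AlgebraicSeries.

(** The two sides differ at the point with all coordinates [c + 1]. *)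
Lemma mpolyX_neq_const n (i : 'I_n) (c : rat) : 'X_i != c%:MP :> {mpoly rat[n]}.
Proof.
apply/eqP => /(congr1 (meval (fun=> c + 1))); rewrite mevalXU mevalC => /eqP.
by rewrite -subr_eq0 addrC addKr oner_eq0.
Qed.

Theorem theorem3p2 :
  algebraic_ser Gser /\
  forall z : nat -> rat,
    z 0%N = 0 -> z 1%N = 1 ->
    let zs : ser {poly rat} := fun n => (z n)%:P in
    (forall n, smul zs (spow (sadd (@sone _) (sneg zs)) 3) n = @tser _ n) ->
    forall n, Ceval G11ser zs n = 0.
Proof.
split; last by move=> z z0 _ zs; apply: G11_root.
rewrite GserE; apply: algebraic_ser_of_frac; apply: algebraic_Gxyser.
- by have := mpolyX_neq_const (inord 2 : 'I_3) 0; rewrite mpolyC0.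
- by have := mpolyX_neq_const (inord 0 : 'I_3) 1; rewrite mpolyC1.
- by have := mpolyX_neq_const (inord 1 : 'I_3) 0; rewrite mpolyC0.
- by have := mpolyX_neq_const (inord 1 : 'I_3) 1; rewrite mpolyC1.
Qed.
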